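(* Fix $\nu_1,\lambda_1,\lambda_2>0$. Suppose a pair of kernels $(P_{Y_1^*|X},P_{Y_2^*|XY_1^*})$ attains the infimum $F(\nu_1,\lambda_1,\lambda_2)$, and let $P_{Y_1^*}$, $P_{Y_2^*|Y_1^*}$ be the induced marginal of $Y_1^*$ and conditional law of $Y_2^*$ given $Y_1^*$. Let the initial $P^0_{Y_1}$, $P^0_{Y_2|Y_1}$ satisfy $D(P_{Y_1^*}\|P^0_{Y_1})<\infty$ and $D(P_{Y_2^*|Y_1^*}\|P^0_{Y_2|Y_1}|P_{Y_1^*})<\infty$, and run the successive-refinement Blahut iteration. Then $(F_k)_{k\ge1}$ is non-increasing, converges to $F(\nu_1,\lambda_1,\lambda_2)$, and for every $k\ge1$ $$F_k-F(\nu_1,\lambda_1,\lambda_2)\le\frac1k\Big((1+\nu_1)D(P_{Y_1^*}\|P^0_{Y_1})+D(P_{Y_2^*|Y_1^*}\|P^0_{Y_2|Y_1}|P_{Y_1^*})\Big).$$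
   Context: $X$ has law $P_X$ on $\mathcal X$; $\mathsf d_1\colon\mathcal X\times\mathcal Y_1\to[0,\infty)$, $\mathsf d_2\colon\mathcal X\times\mathcal Y_2\to[0,\infty)$ measurable; the spaces are such that regular conditional distributions exist (e.g. standard Borel). For kernels $P_{Y_1|X},P_{Y_2|XY_1}$ with $(X,Y_1,Y_2)\sim P_XP_{Y_1|X}P_{Y_2|XY_1}$, $L=I(X;Y_1,Y_2)+\nu_1I(X;Y_1)+\lambda_1\mathbb E[\mathsf d_1(X,Y_1)]+\lambda_2\mathbb E[\mathsf d_2(X,Y_2)]$ and $F(\nu_1,\lambda_1,\lambda_2)=\inf L$. Conditional relative entropy: $D(P_{V|U}\|Q_{V|U}|P_U)=\int D(P_{V|U=u}\|Q_{V|U=u})\,dP_U(u)$. Successive-refinement Blahut iteration: given a probability measure $P^0_{Y_1}$ on $\mathcal Y_1$ and a kernel $P^0_{Y_2|Y_1}$ from $\mathcal Y_1$ to $\mathcal Y_2$, for $k=1,2,\dots$ compute $\beta_2^{k-1}(x|y_1)=\int\exp(-\lambda_2\mathsf d_2(x,y_2))\,P^{k-1}_{Y_2|Y_1=y_1}(dy_2)$, $\beta_1^{k-1}(x)=\int\beta_2^{k-1}(x|y_1)^{\frac1{1+\nu_1}}\exp(-\frac{\lambda_1}{1+\nu_1}\mathsf d_1(x,y_1))\,P^{k-1}_{Y_1}(dy_1)$; define kernels by $\frac{dP^k_{Y_1|X=x}}{dP^{k-1}_{Y_1}}(y_1)=\frac{\beta_2^{k-1}(x|y_1)^{1/(1+\nu_1)}\exp(-\frac{\lambda_1}{1+\nu_1}\mathsf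 d_1(x,y_1))}{\beta_1^{k-1}(x)}$ and $\frac{dP^k_{Y_2|X=x,Y_1=y_1}}{dP^{k-1}_{Y_2|Y_1=y_1}}(y_2)=\frac{\exp(-\lambda_2\mathsf d_2(x,y_2))}{\beta_2^{k-1}(x|y_1)}$; set $F_k=(1+\nu_1)\mathbb E[\log\frac1{\beta_1^{k-1}(X)}]$ (this equals the minimum over $(P_{Y_1|X},P_{Y_2|XY_1})$ of $D(P_{Y_2|XY_1}\|P^{k-1}_{Y_2|Y_1}|P_{XY_1})+(1+\nu_1)D(P_{Y_1|X}\|P^{k-1}_{Y_1}|P_X)+\lambda_1\mathbb E\mathsf d_1(X,Y_1)+\lambda_2\mathbb E\mathsf d_2(X,Y_2)$, attained by the kernels just defined); and let $P^k_{Y_1}$, $P^k_{Y_2|Y_1}$ be the marginal of $Y_1$ and the conditional law of $Y_2$ given $Y_1$ under $P_XP^k_{Y_1|X}P^k_{Y_2|XY_1}$. Logarithms natural. *)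

(* Defs.v *)
From HB Require Import structures.
From mathcomp Require Import all_boot all_order all_algebra.
From mathcomp Require Import all_classical all_reals all_analysis.

Set Implicit Arguments.
Unset Strict Implicit.
Unset Printing Implicit Defensive.

Import Order.TTheory GRing.Theory Num.Theory.
Import numFieldTopology.Exports.

Local Open Scope classical_set_scope.
Local Open Scope ring_scope.
Local Open Scope ereal_scope.

Section mixture.
Context d d' (X : measurableType d) (Y : measurableType d') (R : realType).
Variables (P : {measure set X -> \bar R}) (k : R.-ker X ~> Y).

Definition mixture_fun (A : set Y) : \bar R := \int[P]_x k x A.

Let mixture0 : mixture_fun set0 = 0.
Proof.
by rewrite /mixture_fun (eq_integral (cst 0)) ?integral0// => y _; rewrite measure0.
Qed.

Let mixture_ge0 A : 0 <= mixture_fun A. Proof. exact: integral_ge0. Qed.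

Let mixture_sigma_additive : semi_sigma_additive mixture_fun.
Proof.
move=> U mU tU mUU; rewrite [X in _ --> X](_ : _ =
  \int[P]_y (\sum_(n <oo) k y (U n))); last first.
  apply: eq_integral => V _.
  by apply/esym/cvg_lim => //; exact/measure_semi_sigma_additive.
apply/cvg_closeP; split.
  by apply: is_cvg_nneseries => n _ _; exact: integral_ge0.
rewrite closeE// integral_nneseries// => n.
exact: (measurable_kernel k _ (mU n)).
Qed.

HB.instance Definition _ := isMeasure.Build _ _ R
  mixture_fun mixture0 mixture_ge0 mixture_sigma_additive.

Definition mixture : {measure set Y -> \bar R} := mixture_fun.

End mixture.

(* Relative entropy D(P || Q) (natural logarithm):                           *)
(*   if P has a density f = dP/dQ (P A = \int_A f dQ for measurable A) then  *)
(*   D(P||Q) = \int f ln f dQ  (with 0 ln 0 = 0, as ln 0 = 0 in mathcomp),   *)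
(*   otherwise (P not << Q) D(P||Q) = +oo.                                   *)
(* The value does not depend on the chosen density (they agree Q-a.e.).     *)
Section relative_entropy.
Context d (T : measurableType d) (R : realType).

Definition is_density (P : set T -> \bar R) (Q : {measure set T -> \bar R})
    (f : T -> R) : Prop :=
  [/\ measurable_fun [set: T] f, (forall x, (0 <= f x)%R) &
      forall A, measurable A -> P A = \int[Q]_(x in A) (f x)%:E].

Definition rel_entropy (P : set T -> \bar R) (Q : {measure set T -> \bar R})
    : \bar R :=
  match pselect (exists f, is_density P Q f) with
  | left h => let f := projT1 (cid h) in \int[Q]_x (f x * ln (f x))%:E
  | right _ => +oo
  end.

End relative_entropy.

Definition cond_rel_entropy d d' (U : measurableType d) (V : measurableType d')
    (R : realType) (PVU : U -> {measure set V -> \bar R})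
    (QVU : U -> {measure set V -> \bar R}) (PU : {measure set U -> \bar R})
    : \bar R :=
  \int[PU]_u rel_entropy (PVU u) (QVU u).

Definition mutual_info d d' (X : measurableType d) (Y : measurableType d')
    (R : realType) (PX : probability X R) (K : R.-ker X ~> Y) : \bar R :=
  cond_rel_entropy K (fun _ => mixture PX K) PX.

Section lagrangian.
Context dX d1 d2 (X : measurableType dX) (Y1 : measurableType d1)
  (Y2 : measurableType d2) (R : realType).
Variables (PX : probability X R) (dist1 : X -> Y1 -> R) (dist2 : X -> Y2 -> R).
Variables (nu1 lam1 lam2 : R).

Definition srL (K1 : R.-pker X ~> Y1) (K2 : R.-pker (X * Y1) ~> Y2) : \bar R :=
  mutual_info PX (mkproduct K1 K2)
  + nu1%:E * mutual_info PX K1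
  + lam1%:E * \int[PX]_x \int[K1 x]_y1 (dist1 x y1)%:E
  + lam2%:E * \int[PX]_x \int[K1 x]_y1 \int[K2 (x, y1)]_y2 (dist2 x y2)%:E.

Definition srF : \bar R :=
  ereal_inf [set v | exists (K1 : R.-pker X ~> Y1)
                            (K2 : R.-pker (X * Y1) ~> Y2), v = srL K1 K2].

End lagrangian.

(* Q21 is a version of the conditional law of Y2 given Y1 when
   (X, Y1, Y2) ~ PX K1 K2 and Y1 has marginal PY1:
   for measurable A, B:  P(Y1 in A, Y2 in B) = \int_A Q21(y1)(B) dPY1(y1). *)
Definition is_cond_law dX d1 d2 (X : measurableType dX) (Y1 : measurableType d1)
    (Y2 : measurableType d2) (R : realType) (PX : probability X R)
    (K1 : R.-pker X ~> Y1) (K2 : R.-pker (X * Y1) ~> Y2)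
    (PY1 : {measure set Y1 -> \bar R}) (Q21 : R.-pker Y1 ~> Y2) : Prop :=
  forall A B, measurable A -> measurable B ->
    \int[PY1]_(y1 in A) Q21 y1 B =
    \int[PX]_x \int[K1 x]_(y1 in A) K2 (x, y1) B.

Section blahut.
Context dX d1 d2 (X : measurableType dX) (Y1 : measurableType d1)
  (Y2 : measurableType d2) (R : realType).
Variables (dist1 : X -> Y1 -> R) (dist2 : X -> Y2 -> R).
Variables (nu1 lam1 lam2 : R).

Definition beta2 (P21 : R.-pker Y1 ~> Y2) (x : X) (y1 : Y1) : R :=
  fine (\int[P21 y1]_y2 (expR (- (lam2 * dist2 x y2))%R)%:E).

Definition beta1 (P1 : probability Y1 R) (P21 : R.-pker Y1 ~> Y2) (x : X) : R :=
  fine (\int[P1]_y1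
    (beta2 P21 x y1 `^ (1 + nu1)^-1 *
     expR (- (lam1 / (1 + nu1) * dist1 x y1)))%R%:E).

End blahut.

(* Main.v *)
Require Import Defs.
From HB Require Import structures.
From mathcomp Require Import all_boot all_order all_algebra.
From mathcomp Require Import all_classical all_reals all_analysis.
From mathcomp Require Import measurable_realfun ring lra.

Set Implicit Arguments.
Unset Strict Implicit.
Unset Printing Implicit Defensive.

Import Order.TTheory GRing.Theory Num.Theory.
Import numFieldTopology.Exports.

Local Open Scope classical_set_scope.
Local Open Scope ring_scope.
Local Open Scope ereal_scope.

(* Averaged over the law of (X, Y1, Y2), the identity
     (1 + nu1) ln (1 / beta1 x) =
       ln q + nu1 ln f1 + lam1 d1 + lam2 d2,
   where f1 and q are the densities of the new kernels X -> Y1 and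
   X -> Y1 * Y2 with respect to the old output laws, compares every F_k with
   the Lagrangian.  Let g and h be the densities of the new output laws with
   respect to the old ones.  Under the optimal law the variational (Gibbs)
   inequality, applied to the functions ln (q / h) and ln (f1 / g), bounds
   F_{k+1} - F by E[ln h + nu1 ln g].  These quantities telescope along the
   iteration, and a further Gibbs inequality against the initial laws bounds
   their sum by (1 + nu1) D(P_{Y1*} || P^0) + D(P_{Y2*|Y1*} || P^0 | P_{Y1*}).
   As F_k is nonincreasing and at least F, the 1/k rate follows.

   On arbitrary measurable spaces u |-> D(P_u || Q_u) need not be measurable,
   so conditional relative entropies are lower integrals; they are only ever
   bounded from below, by jointly measurable expressions.  All the inequalities
   are between integrals of nonnegative functions, which avoids integrability
   side conditions: ln u is handled through u ln u - u + 1 >= 0 and through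
   positive and negative parts. *)

(** The initial divergences bound sums of [ln (h k)] and [ln (g k)] along the iteration, not single
    terms, so the comparison with the optimum is not made one step at a time. Gibbs is applied once
    to the arithmetic mean of the first [n+1] functions [ln (q / h)] and once to that of the
    [ln (f1 / g)]; convexity of the exponential keeps the exponential moments at most 1. With [S]
    and [S1] the accumulated logarithms on [Y1 * Y2] and on [Y1], the telescoped remainder
    [S + nu1 * S1] is regrouped as [(S - S1) + (1 + nu1) * S1]. The first term is paid for by the
    conditional divergence, the second by the divergence on [Y1], whence the constant [1 + nu1]. A
    second obstacle is that the output densities are finite only almost everywhere under the current
    law, but are used under the optimal one. Positivity of the densities carries the exceptional
    null sets back to the initial law, and finiteness of the initial divergences carries them on to
    the optimal law. *)

(** * Integration against superpositions of measures and against densities *)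

Section superposition.
Context d d' (U : measurableType d) (Z : measurableType d') (R : realType).
Variables (P : {measure set U -> \bar R}) (k : U -> {measure set Z -> \bar R}).
Variable m : {measure set Z -> \bar R}.
Hypothesis mk : forall A, measurable A -> measurable_fun [set: U] (k ^~ A).
Hypothesis mE : forall A, measurable A -> m A = \int[P]_u k u A.

Import HBNNSimple.

Let integral_superposition_nnsfun (f : {nnsfun Z >-> R}) :
  \int[m]_z (f z)%:E = \int[P]_u \int[k u]_z (f z)%:E.
Proof.
under [in LHS]eq_integral do rewrite fimfunE -fsumEFin//.
rewrite ge0_integral_fsum//; last 2 first.
  - by move=> r; exact/measurable_EFinP/measurableT_comp.
  - by move=> r z _; rewrite EFinM nnfun_muleindic_ge0.
under [in RHS]eq_integral.
  move=> y _.
  under eq_integral.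
    by move=> z _; rewrite fimfunE -fsumEFin//; over.
  rewrite /= ge0_integral_fsum//; last 2 first.
    - by move=> r; exact/measurable_EFinP/measurableT_comp.
    - by move=> r z _; rewrite EFinM nnfun_muleindic_ge0.
  under eq_fsbigr.
    move=> r _.
    rewrite (integralZl_indic _ (fun r => f @^-1` [set r]))//; last first.
      by move=> r0; rewrite preimage_nnfun0.
    rewrite integral_indic// setIT.
    over.
  over.
rewrite /= ge0_integral_fsum//; last 2 first.
  - by move=> r; apply: measurable_funeM; exact: mk.
  - move=> n y _.
    have := mulemu_ge0 (fun n => f @^-1` [set n]).
    by apply; exact: preimage_nnfun0.
apply: eq_fsbigr => r _.
rewrite (integralZl_indic _ (fun r => f @^-1` [set r]))//; last first.
  exact: preimage_nnfun0.
rewrite integral_indic// setIT mE//.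
have [r0|r0] := leP 0%R r.
  by rewrite ge0_integralZl//; exact: mk.
rewrite integral0_eq ?mule0; last first.
  by move=> y _; rewrite preimage_nnfun0// measure0.
by rewrite integral0_eq// => y _; rewrite preimage_nnfun0// measure0 mule0.
Qed.

(** Simple functions, then monotone convergence. [k] is a bare family of measures rather than a
    kernel, so the same lemma serves mixtures, weighted Dirac masses and kernel products. *)
Lemma integral_superposition (f : Z -> \bar R) :
  (forall z, 0 <= f z) -> measurable_fun [set: Z] f ->
  \int[m]_z f z = \int[P]_u \int[k u]_z f z.
Proof.
move=> f0 mf.
pose f_ := nnsfun_approx measurableT mf.
have mf_ n : measurable_fun [set: Z] (EFin \o f_ n) by exact/measurable_EFinP.
have nd_f z : {homo (fun n => (f_ n z)%:E) : a b / (a <= b)%N >-> a <= b}.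
  by move=> a b ab; rewrite lee_fin; exact/lefP/nd_nnsfun_approx.
have cvg_int (mu : {measure set Z -> \bar R}) :
    \int[mu]_z f z = lim ((\int[mu]_z (f_ n z)%:E) @[n --> \oo]).
  rewrite -monotone_convergence//.
  - by apply: eq_integral => z _; apply/esym/cvg_lim => //;
      exact: cvg_nnsfun_approx.
  - by move=> n z _; rewrite lee_fin.
rewrite cvg_int; under eq_fun do rewrite integral_superposition_nnsfun.
under [RHS]eq_integral do rewrite cvg_int.
rewrite -monotone_convergence//; last 3 first.
- move=> n; apply: measurable_fun_integral_kernel => // [z|].
    by rewrite lee_fin.
  exact: mf_.
- by move=> n y _; apply: integral_ge0 => // z _; rewrite lee_fin.
- move=> y _ a b ab; apply: ge0_le_integral => //.
  + by move=> z _; rewrite lee_fin.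
  + exact: mf_.
  + exact: mf_.
  + by move=> z _; exact: nd_f.
Qed.

End superposition.

Section density.
Context d (T : measurableType d) (R : realType).
Variables (Q m : {measure set T -> \bar R}) (f : T -> R).
Hypotheses (mf : measurable_fun [set: T] f) (f0 : forall x, (0 <= f x)%R).
Hypothesis mE : forall A, measurable A -> m A = \int[Q]_(x in A) (f x)%:E.

Lemma integral_density (g : T -> \bar R) :
  (forall x, 0 <= g x) -> measurable_fun [set: T] g ->
  \int[m]_x g x = \int[Q]_x ((f x)%:E * g x).
Proof.
move=> g0 mg.
(* A measure with density [f] is the superposition of the Dirac masses weighted by [f]. *)
pose k x : {measure set T -> \bar R} := mscale (NngNum (f0 x)) \d_x.
rewrite (@integral_superposition _ _ _ _ _ Q k)//; last 2 first.
- move=> A mA; rewrite /k/= /mscale/=.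
  under eq_fun do rewrite /mscale/=.
  apply: emeasurable_funM; first exact/measurable_EFinP.
  rewrite /dirac; apply/measurable_EFinP.
  exact: measurable_indic.
- move=> A mA; rewrite mE// integral_mkcond; apply: eq_integral => x _.
  rewrite /k/= /mscale/= /dirac patchE indicE.
  by case: ifPn => _; rewrite ?mule1 ?mule0.
apply: eq_integral => x _; rewrite ge0_integral_mscale//= integral_dirac//.
by rewrite diracT mul1e.
Qed.

End density.

(** * Lower integrals of nonnegative functions *)

Section lower_integral.
Context d (T : measurableType d) (R : realType).
Variable mu : {measure set T -> \bar R}.

(** The integral of a nonnegative function is a supremum over the simple functions below it, hence
    monotone even on nonmeasurable functions. *)
Lemma ge0_le_integralT (f g : T -> \bar R) : (forall x, 0 <= f x) ->
  (forall x, f x <= g x) -> \int[mu]_x f x <= \int[mu]_x g x.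
Proof.
move=> f0 fg; have g0 x : 0 <= g x by exact: le_trans (f0 x) (fg x).
rewrite !ge0_integralTE//; apply: le_ereal_sup => _ [h /= hf <-].
by exists h => //= x; exact: le_trans (fg x).
Qed.

(** Additivity may fail for the nonmeasurable [D], so [D] is first replaced by the measurable
    minorant [max (a - b) 0], which still satisfies the pointwise inequality. Where [b] is infinite
    the minorant is 0. *)
Lemma ge0_le_lower_integralD (a b D : T -> \bar R) :
  measurable_fun [set: T] a -> measurable_fun [set: T] b ->
  (forall x, 0 <= a x) -> (forall x, 0 <= b x) -> (forall x, 0 <= D x) ->
  (forall x, a x <= D x + b x) ->
  \int[mu]_x a x <= \int[mu]_x D x + \int[mu]_x b x.
Proof.
move=> ma mb a0 b0 D0 aDb; pose e x := maxe (a x - b x) 0.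
have e0 x : 0 <= e x by rewrite /e le_max lexx orbT.
have me : measurable_fun [set: T] e.
  by apply: measurable_maxe => //; exact: emeasurable_funB.
have eD x : e x <= D x.
  rewrite /e ge_max D0 andbT; have := aDb x; have := a0 x; have := b0 x.
  have := D0 x; case: (a x) => [r| |]; case: (b x) => [s| |];
    case: (D x) => [t| |]//=; rewrite ?leey ?addeNy ?leNye//.
  by rewrite -EFinD !lee_fin => _ _ _ ?; rewrite lerBlDr.
have aeb x : a x <= e x + b x.
  have := b0 x; case E : (b x) => [s| |] // _.
    by rewrite -leeBlDr// -E /e le_max lexx.
  by rewrite addey ?leey// -ltNye (lt_le_trans _ (e0 x)).
apply: (@le_trans _ _ (\int[mu]_x (e x + b x))).
  by apply: ge0_le_integralT.
rewrite ge0_integralD//; apply: leeD => //.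
exact: ge0_le_integralT.
Qed.

End lower_integral.

Lemma integral_gt0 d (T : measurableType d) (R : realType)
    (mu : {measure set T -> \bar R}) (f : T -> \bar R) : mu setT != 0 ->
  measurable_fun [set: T] f -> (forall x, 0 < f x) -> 0 < \int[mu]_x f x.
Proof.
move=> mu0 mf f0; rewrite lt0e; apply/andP; split; last first.
  by apply: integral_ge0 => x _; exact: ltW.
apply/eqP => If.
have : \int[mu]_x `|f x| = 0.
  by rewrite -[RHS]If; apply: eq_integral => x _; rewrite gee0_abs// ltW.
move/(ae_eq_integral_abs _ measurableT mf) => [N [mN N0 subN]].
have NT : N = setT.
  by apply/seteqP; split => // x _; apply: subN => /= /(_ Logic.I) fx;
    have := f0 x; rewrite fx ltxx.
by move: mu0; rewrite -NT N0 eqxx.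
Qed.

(** * Mixtures, joint laws and products of kernels *)

Section mixture_probability.
Context d d' (X : measurableType d) (Y : measurableType d') (R : realType).

Lemma integral_mixture (P : {measure set X -> \bar R}) (k : R.-ker X ~> Y)
    (f : Y -> \bar R) : (forall y, 0 <= f y) -> measurable_fun [set: Y] f ->
  \int[mixture P k]_y f y = \int[P]_x \int[k x]_y f y.
Proof. by apply: integral_superposition => // A mA; exact: measurable_kernel. Qed.

Variables (P : probability X R) (k : R.-pker X ~> Y).

Let mixture_setT : mixture P k [set: Y] = 1.
Proof.
rewrite /mixture/= /mixture_fun (eq_integral (cst 1)).
  by rewrite integral_cst// mul1e; exact: probability_setT.
by move=> x _; rewrite prob_kernel.
Qed.

HB.instance Definition _ := Measure_isProbability.Build _ _ R
  (mixture_fun P k) mixture_setT.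

End mixture_probability.

Section graph_kernel.
Context d d' (U : measurableType d) (V : measurableType d') (R : realType).

Definition graph_measure (mu : {measure set V -> \bar R}) (u : U) :
  {measure set (U * V) -> \bar R}.
Proof.
refine (pushforward mu (pair u) : {measure set (U * V) -> \bar R}).
exact: pair1_measurable.
Defined.

Lemma integral_graph_measure (mu : {measure set V -> \bar R}) (u : U)
    (f : U * V -> \bar R) :
  (forall z, 0 <= f z) -> measurable_fun [set: U * V] f ->
  \int[graph_measure mu u]_z f z = \int[mu]_v f (u, v).
Proof.
by move=> f0 mf; rewrite /graph_measure ge0_integral_pushforward.
Qed.

Variable k : R.-pker U ~> V.

Definition graph_kernel (u : U) : {measure set (U * V) -> \bar R} :=
  graph_measure (k u) u.

Let measurable_graph_kernel A :
  measurable A -> measurable_fun [set: U] (graph_kernel ^~ A).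
Proof.
move=> mA; rewrite (_ : (fun u => _) = fun u => k u (xsection A u)).
  by apply: measurable_fun_xsection_finite_kernel; rewrite inE.
by apply/funext => u; rewrite /graph_kernel/= /pushforward xsectionE.
Qed.

HB.instance Definition _ := isKernel.Build _ _ _ _ R
  graph_kernel measurable_graph_kernel.

Let graph_kernel_prob u : graph_kernel u setT = 1.
Proof. by rewrite /graph_kernel/= /pushforward preimage_setT prob_kernel. Qed.

HB.instance Definition _ := Kernel_isProbability.Build _ _ _ _ R
  graph_kernel graph_kernel_prob.

End graph_kernel.

Section semidirect.
Context d d' (U : measurableType d) (V : measurableType d') (R : realType).

(** The joint law of a [P]-distributed input and its output through [k], encoded as a mixture of
    laws carried by the fibres so that the integration lemma for mixtures applies. *)
Definition semidirect (P : probability U R) (k : R.-pker U ~> V) :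
  probability (U * V)%type R := mixture_fun P (graph_kernel k).

Variables (P : probability U R) (k : R.-pker U ~> V).

Lemma integral_semidirect (f : U * V -> \bar R) :
  (forall z, 0 <= f z) -> measurable_fun [set: U * V] f ->
  \int[semidirect P k]_z f z = \int[P]_u \int[k u]_v f (u, v).
Proof.
move=> f0 mf; rewrite integral_mixture//; apply: eq_integral => u _.
exact: integral_graph_measure.
Qed.

Lemma semidirectX A B : measurable A -> measurable B ->
  semidirect P k (A `*` B) = \int[P]_(u in A) k u B.
Proof.
move=> mA mB; rewrite [RHS]integral_mkcond; apply: eq_integral => u _.
rewrite /= /pushforward patchE -xsectionE; case: ifPn => uA.
  by rewrite in_xsectionX.
by rewrite notin_xsectionX// measure0.
Qed.

End semidirect.

Lemma measure_unique_prod d d' (U : measurableType d) (V : measurableType d')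
    (R : realType) (m1 m2 : {measure set (U * V) -> \bar R}) :
  m1 setT < +oo ->
  (forall A B, measurable A -> measurable B -> m1 (A `*` B) = m2 (A `*` B)) ->
  forall C, measurable C -> m1 C = m2 C.
Proof.
move=> m1T m12 C mC.
apply: (@measure_unique _ R _
  [set A `*` B | A in measurable & B in measurable] (fun=> setT)) => //.
- exact: measurable_prod_measurableType.
- move=> _ _ [A1 mA1 [B1 mB1 <-]] [A2 mA2 [B2 mB2 <-]].
  exists (A1 `&` A2); first exact: measurableI.
  by exists (B1 `&` B2); [exact: measurableI|rewrite setXI].
- by move=> _; exists setT => //; exists setT => //; rewrite setXTT.
- by rewrite bigcup_const.
- by move=> _ [A mA [B mB <-]]; exact: m12.
Qed.

Section mkproduct_probability.
Context d0 d1 d2 (X : measurableType d0) (Y : measurableType d1)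
  (Z : measurableType d2) (R : realType).
Variables (k1 : R.-pker X ~> Y) (k2 : R.-pker (X * Y) ~> Z).

Lemma integral_mkproduct x (f : Y * Z -> \bar R) :
  (forall z, 0 <= f z) -> measurable_fun [set: Y * Z] f ->
  \int[mkproduct k1 k2 x]_z f z = \int[k1 x]_y \int[k2 (x, y)]_z f (y, z).
Proof.
move=> f0 mf.
have E A y : measurable A ->
    graph_measure (k2 (x, y)) y A = \int[k2 (x, y)]_z (\1_A (y, z))%:E.
  move=> mA; rewrite -(@integral_graph_measure _ _ _ _ _ _ _ (EFin \o \1_A)).
  - by rewrite /comp integral_indic// setIT.
  - by move=> z; rewrite lee_fin.
  - exact/measurable_EFinP/measurable_indic.
(* At fixed [x] the product kernel is the superposition, over [y] drawn from [k1 x], of the laws of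
   [(y, Z)] with [Z] drawn from [k2 (x, y)]. *)
rewrite (@integral_superposition _ _ _ _ _ (k1 x)
    (fun y => graph_measure (k2 (x, y)) y))//.
- by apply: eq_integral => y _; rewrite integral_graph_measure.
- move=> A mA; under eq_fun do rewrite E//.
  pose g (p : (X * Y) * Z) : \bar R := (\1_A (p.1.2, p.2))%:E.
  have : measurable_fun [set: X * Y] (fun p => \int[k2 p]_z g (p, z)).
    apply: measurable_fun_integral_finite_kernel.
      by move=> p; rewrite lee_fin.
    apply/measurable_EFinP; apply: measurableT_comp => //.
    by apply: measurable_fun_pair => //; exact: measurableT_comp.
  by move=> mg; exact: (measurableT_comp mg (pair1_measurable x)).
- by move=> A mA; apply: eq_integral => y _; rewrite E.
Qed.

Let mkproduct_setT x : mkproduct k1 k2 x [set: Y * Z] = 1.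
Proof.
rewrite -[LHS]mul1e -integral_cst// integral_mkproduct//.
rewrite (eq_integral (cst 1)) ?integral_cst// ?mul1e ?prob_kernel// => y _.
by rewrite integral_cst// mul1e prob_kernel.
Qed.

HB.instance Definition _ := Kernel_isProbability.Build _ _ _ _ R
  (mkproduct k1 k2) mkproduct_setT.

End mkproduct_probability.

(** * The entropy integrand and the Gibbs inequality *)

Section entropy_integrand.
Context {R : realType}.
Local Open Scope ring_scope.

(** The added [- u + 1] integrates to zero when [u] is a density between probabilities. *)
Definition klfun (u : R) : R := u * ln u - u + 1.

(** The Fenchel-Young inequality: [klfun] and [expR t - 1] are convex conjugates. For [u > 0] it is
    the tangent bound on [expR] at [t - ln u]. *)
Lemma young_klfun (u t : R) : 0 <= u -> u * t + 1 <= klfun u + expR t.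
Proof.
rewrite le_eqVlt /klfun => /orP[/eqP <-|u0].
  by rewrite !mul0r subr0 add0r lerDl expR_ge0.
have := expR_ge1Dx (t - ln u); rewrite expRD expRN lnK ?posrE// => h.
have : u * (1 + (t - ln u)) <= expR t.
  by rewrite mulrC -ler_pdivlMr.
lra.
Qed.

Lemma klfun_ge0 (u : R) : 0 <= u -> 0 <= klfun u.
Proof. by move=> /(young_klfun 0); rewrite mulr0 add0r expR0 lerDr. Qed.

Lemma measurable_klfun : measurable_fun [set: R] klfun.
Proof.
apply: measurable_funD => //; apply: measurable_funB => //.
by apply: measurable_funM => //; exact: measurable_ln.
Qed.

Lemma posr_negr (t : R) : Num.max t 0 - Num.max (- t) 0 = t.
Proof. by case: (leP t 0); case: (leP (- t) 0) => *; lra. Qed.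

End entropy_integrand.

Section relative_entropy_lemmas.
Context d (T : measurableType d) (R : realType).
Implicit Types P Q : {measure set T -> \bar R}.

(** Both sides may be [+oo], so the identity is first proved between sums of nonnegative integrals;
    only the negative part of [f ln f], whose integral is finite, is then subtracted. *)
Lemma integral_flnf P Q (f : T -> R) : P setT = 1 -> Q setT = 1 ->
  is_density P Q f ->
  \int[Q]_x (f x * ln (f x))%:E = \int[Q]_x (klfun (f x))%:E.
Proof.
move=> P1 Q1 [mf f0 Pf].
set g := fun x => (f x * ln (f x))%:E.
have mfl : measurable_fun [set: T] (fun x => f x * ln (f x))%R.
  by apply: measurable_funM => //; exact: measurableT_comp (@measurable_ln R) mf.
have mg : measurable_fun [set: T] g by exact/measurable_EFinP.
have mk : measurable_fun [set: T] (fun x => (klfun (f x))%:E).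
  by apply/measurable_EFinP; exact: measurableT_comp measurable_klfun mf.
have mF : measurable_fun [set: T] (fun x => (f x)%:E) by exact/measurable_EFinP.
have k0 x : 0 <= (klfun (f x))%:E by rewrite lee_fin klfun_ge0.
have F0 x : 0 <= (f x)%:E by rewrite lee_fin.
have gn0 x : 0 <= g^\- x by exact: funeneg_ge0.
have gp0 x : 0 <= g^\+ x by exact: funepos_ge0.
have mgn := measurable_funeneg mg; have mgp := measurable_funepos mg.
have gE x : g^\+ x + 1 = (klfun (f x))%:E + ((f x)%:E + g^\- x).
  rewrite funeposE funenegE /g /= -!EFin_max -!EFinD /klfun.
  by congr EFin; have := posr_negr (f x * ln (f x)); lra.
(* Nonnegativity of [klfun] gives [f ln f >= f - 1 >= -1]. *)
have gn1 x : g^\- x <= 1.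
  rewrite funenegE /g /= -EFin_max lee_fin ge_max ler01 andbT.
  by have := klfun_ge0 (f0 x); have := f0 x; rewrite /klfun; lra.
have fin_n : \int[Q]_x g^\- x \is a fin_num.
  rewrite ge0_fin_numE ?integral_ge0//.
  apply: (@le_lt_trans _ _ (\int[Q]_x (cst 1) x)).
    exact: ge0_le_integralT.
  by rewrite integral_cst// Q1 mule1 ltry.
have : \int[Q]_x g^\+ x + 1 =
    \int[Q]_x (klfun (f x))%:E + (1 + \int[Q]_x g^\- x).
  have PF : \int[Q]_x (f x)%:E = 1 by rewrite -Pf.
  have QT : \int[Q]_x (cst 1) x = 1 by rewrite integral_cst// Q1 mule1.
  rewrite -[X in _ + X = _]QT -[X in _ = _ + (X + _)]PF -!ge0_integralD//.
  - by apply: eq_integral => x _; rewrite /= gE.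
  - by move=> x _; rewrite adde_ge0.
  - exact: emeasurable_funD.
move=> H; rewrite integralE -[X in X - _](@addeK _ 1)// H.
by rewrite (addeC 1) addeA !addeK.
Qed.

Lemma is_density_unique P Q (f g : T -> R) : P setT = 1 ->
  is_density P Q f -> is_density P Q g ->
  ae_eq Q setT (EFin \o f) (EFin \o g).
Proof.
move=> P1 [mf f0 Pf] [mg g0 Pg]; apply: integral_ae_eq => //.
- apply/integrableP; split; first exact/measurable_EFinP.
  rewrite (eq_integral (fun x => (f x)%:E)); last first.
    by move=> x _; rewrite /= ger0_norm.
  by rewrite -Pf// P1 ltry.
- exact/measurable_EFinP.
- by move=> E _ mE; rewrite -Pf// -Pg.
Qed.

Lemma rel_entropyE P Q (f : T -> R) : P setT = 1 -> Q setT = 1 ->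
  is_density P Q f -> rel_entropy P Q = \int[Q]_x (klfun (f x))%:E.
Proof.
move=> P1 Q1 Pf; rewrite /rel_entropy; case: pselect => [h|]; last first.
  by case; exists f.
case: (cid h) => g /= Pg; rewrite (integral_flnf P1 Q1 Pg).
have [mf f0 _] := Pf; have [mg g0 _] := Pg.
apply: ge0_ae_eq_integral => //.
- by apply/measurable_EFinP; exact: measurableT_comp measurable_klfun mg.
- by apply/measurable_EFinP; exact: measurableT_comp measurable_klfun mf.
- by move=> x _; rewrite lee_fin klfun_ge0.
- by move=> x _; rewrite lee_fin klfun_ge0.
- have [N [mN N0 sN]] := is_density_unique P1 Pg Pf.
  by exists N; split => // x /= nfg; apply: sN => /= h'; apply: nfg => _;
    have /= [->] := h' Logic.I.
Qed.

Lemma rel_entropy_lty P Q : rel_entropy P Q < +oo ->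
  exists f, is_density P Q f.
Proof. by rewrite /rel_entropy; case: pselect. Qed.

Lemma rel_entropy_ge0 P Q : P setT = 1 -> Q setT = 1 -> 0 <= rel_entropy P Q.
Proof.
move=> P1 Q1; have [[f Pf]|nP] := pselect (exists f, is_density P Q f).
  rewrite (rel_entropyE P1 Q1 Pf); have [_ f0 _] := Pf.
  by apply: integral_ge0 => x _; rewrite lee_fin klfun_ge0.
by rewrite /rel_entropy; case: pselect.
Qed.

(** [young_klfun] at the density of [P], integrated against [Q]; the 1 is the mass of [Q]. The
    positive and negative parts of [t] sit on opposite sides, so no difference of infinities is
    formed. *)
Lemma gibbs P Q (t : T -> R) : P setT = 1 -> Q setT = 1 ->
  measurable_fun [set: T] t ->
  \int[P]_x (Num.max (t x) 0%R)%:E + 1 <= rel_entropy P Q +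
    (\int[Q]_x (expR (t x))%:E + \int[P]_x (Num.max (- t x) 0)%R%:E).
Proof.
move=> P1 Q1 mt.
have mtp : measurable_fun [set: T] (fun x => (Num.max (t x) 0%R)%:E).
  by apply/measurable_EFinP; exact: measurable_maxr.
have mtn : measurable_fun [set: T] (fun x => (Num.max (- t x) 0)%R%:E).
  by apply/measurable_EFinP; apply: measurable_maxr => //;
    exact: measurableT_comp.
have met : measurable_fun [set: T] (fun x => (expR (t x))%:E).
  by apply/measurable_EFinP; exact: measurableT_comp.
have tp0 x : 0 <= (Num.max (t x) 0%R)%:E by rewrite lee_fin le_max lexx orbT.
have tn0 x : 0 <= (Num.max (- t x) 0%R)%:E by rewrite lee_fin le_max lexx orbT.
have et0 x : 0 <= (expR (t x))%:E by rewrite lee_fin expR_ge0.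
have [[f Pf]|nP] := pselect (exists f, is_density P Q f); last first.
  rewrite {1}/rel_entropy; case: pselect => // _.
  by rewrite addye ?leey// -ltNye (@lt_le_trans _ _ 0)// adde_ge0//
    integral_ge0.
rewrite (rel_entropyE P1 Q1 Pf); have [mf f0 Pfd] := Pf.
have mF : measurable_fun [set: T] (fun x => (f x)%:E) by exact/measurable_EFinP.
have mk : measurable_fun [set: T] (fun x => (klfun (f x))%:E).
  by apply/measurable_EFinP; exact: measurableT_comp measurable_klfun mf.
have k0 x : 0 <= (klfun (f x))%:E by rewrite lee_fin klfun_ge0.
rewrite !(integral_density mf f0 Pfd)//.
have QT : \int[Q]_x (cst 1) x = 1 by rewrite integral_cst// Q1 mule1.
rewrite -[X in _ + X <= _]QT.
have ftp0 x : 0 <= (f x)%:E * (Num.max (t x) 0)%R%:E.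
  by rewrite mule_ge0// lee_fin.
have ftn0 x : 0 <= (f x)%:E * (Num.max (- t x) 0)%R%:E.
  by rewrite mule_ge0// lee_fin.
have mft : measurable_fun [set: T] (fun x => (f x)%:E * (Num.max (t x) 0)%R%:E).
  exact: emeasurable_funM.
have mfn : measurable_fun [set: T] (fun x => (f x)%:E * (Num.max (- t x) 0)%R%:E).
  exact: emeasurable_funM.
rewrite -!ge0_integralD//; last 2 first.
- by move=> x _; rewrite adde_ge0.
- exact: emeasurable_funD.
apply: ge0_le_integralT => x; first by rewrite adde_ge0.
rewrite -!EFinM -!EFinD lee_fin.
have := young_klfun (t x) (f0 x); rewrite -[in X in X -> _](posr_negr (t x)).
rewrite mulrBr posr_negr; lra.
Qed.

(** [gibbs] for [max t 0], whose exponential is at most [1 + expR t]; the extra 1 cancels. This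
    yields integrability of the positive part from a finite divergence. *)
Lemma gibbs_pos P Q (t : T -> R) : P setT = 1 -> Q setT = 1 ->
  measurable_fun [set: T] t ->
  \int[P]_x (Num.max (t x) 0%R)%:E <=
  rel_entropy P Q + \int[Q]_x (expR (t x))%:E.
Proof.
move=> P1 Q1 mt; pose s x := Num.max (t x) 0%R.
have s0 x : (0 <= s x)%R by rewrite /s le_max lexx orbT.
have ms : measurable_fun [set: T] s by exact: measurable_maxr.
rewrite -(@leeD2rE _ 1)//.
have := gibbs P1 Q1 ms; move: (rel_entropy P Q) => D.
rewrite (eq_integral (fun x => (Num.max (t x) 0%R)%:E)); last first.
  by move=> x _; rewrite (max_idPl (s0 _)).
have -> : \int[P]_x (Num.max (- s x) 0)%R%:E = 0.
  apply: integral0_eq => x _; congr EFin; apply/max_idPr.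
  by rewrite oppr_le0.
move=> /le_trans; apply.
rewrite -(addeA D); apply: (leeD2l D); rewrite [leLHS]adde0.
have QT : \int[Q]_x (cst 1) x = 1 by rewrite integral_cst// Q1 mule1.
rewrite -[X in _ <= _ + X]QT -[leRHS]ge0_integralD//; last first.
  by apply/measurable_EFinP; exact: measurableT_comp.
apply: ge0_le_integralT => x; first by rewrite lee_fin expR_ge0.
rewrite -EFinD lee_fin /s; move: (t x) => r.
by case: (leP r 0%R) => _; rewrite ?expR0; have := expR_ge0 r; lra.
Qed.

End relative_entropy_lemmas.

(** * Conditional Gibbs inequalities and transfer of null sets *)

Section conditional_gibbs.
Context d d' (U : measurableType d) (V : measurableType d') (R : realType).
Variables (PU : probability U R) (P : R.-pker U ~> V).
Variable Q : U -> {measure set V -> \bar R}.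
Hypothesis Q1 : forall u, Q u setT = 1.

Lemma cond_rel_entropy_ge0 : 0 <= cond_rel_entropy P Q PU.
Proof.
by apply: integral_ge0 => u _; rewrite rel_entropy_ge0// prob_kernel.
Qed.

(** [gibbs] on each fibre, then integration over [u]. The fibrewise divergence is the one term whose
    measurability is unknown, hence [ge0_le_lower_integralD]. *)
Lemma cond_gibbs (t : U * V -> R) : measurable_fun [set: U * V] t ->
  measurable_fun [set: U] (fun u => \int[Q u]_v (expR (t (u, v)))%:E) ->
  \int[PU]_u \int[P u]_v (Num.max (t (u, v)) 0%R)%:E + 1 <=
  cond_rel_entropy P Q PU + (\int[PU]_u \int[Q u]_v (expR (t (u, v)))%:E +
    \int[PU]_u \int[P u]_v (Num.max (- t (u, v)) 0)%R%:E).
Proof.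
move=> mt mQ.
have mtp : measurable_fun [set: U]
    (fun u => \int[P u]_v (Num.max (t (u, v)) 0%R)%:E).
  apply: (measurable_fun_integral_finite_kernel
    (fun p => (Num.max (t p) 0%R)%:E)).
    by move=> z; rewrite lee_fin le_max lexx orbT.
  by apply/measurable_EFinP; exact: measurable_maxr.
have mtn : measurable_fun [set: U]
    (fun u => \int[P u]_v (Num.max (- t (u, v)) 0%R)%:E).
  apply: (measurable_fun_integral_finite_kernel
    (fun p => (Num.max (- t p) 0%R)%:E)).
    by move=> z; rewrite lee_fin le_max lexx orbT.
  apply/measurable_EFinP; apply: measurable_maxr => //.
  exact: measurableT_comp.
have tp0 u : 0 <= \int[P u]_v (Num.max (t (u, v)) 0%R)%:E.
  by apply: integral_ge0 => v _; rewrite lee_fin le_max lexx orbT.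
have tn0 u : 0 <= \int[P u]_v (Num.max (- t (u, v)) 0%R)%:E.
  by apply: integral_ge0 => v _; rewrite lee_fin le_max lexx orbT.
have et0 u : 0 <= \int[Q u]_v (expR (t (u, v)))%:E.
  by apply: integral_ge0 => v _; rewrite lee_fin expR_ge0.
have PU1 : \int[PU]_u (cst 1) u = 1.
  by rewrite integral_cst// mul1e; exact: probability_setT.
rewrite -[X in _ + X <= _]PU1 -[leLHS]ge0_integralD//.
rewrite -[X in _ <= _ + X]ge0_integralD//.
apply: ge0_le_lower_integralD => //.
- exact: emeasurable_funD.
- exact: emeasurable_funD.
- by move=> u; rewrite adde_ge0.
- by move=> u; rewrite adde_ge0.
- by move=> u; rewrite rel_entropy_ge0// prob_kernel.
- move=> u /=; apply: gibbs => //; first exact: prob_kernel.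
  exact: measurable_fun_pair2.
Qed.

Lemma cond_gibbs_pos (t : U * V -> R) : measurable_fun [set: U * V] t ->
  (forall g : U * V -> R, measurable_fun [set: U * V] g ->
    (forall z, 0 <= g z)%R ->
    measurable_fun [set: U] (fun u => \int[Q u]_v (g (u, v))%:E)) ->
  \int[PU]_u \int[P u]_v (Num.max (t (u, v)) 0%R)%:E <=
  cond_rel_entropy P Q PU + \int[PU]_u \int[Q u]_v (expR (t (u, v)))%:E.
Proof.
move=> mt mQ; pose s z := Num.max (t z) 0%R.
have s0 z : (0 <= s z)%R by rewrite /s le_max lexx orbT.
have ms : measurable_fun [set: U * V] s by exact: measurable_maxr.
have mes : measurable_fun [set: U * V] (expR \o s) by exact: measurableT_comp.
have met : measurable_fun [set: U * V] (expR \o t) by exact: measurableT_comp.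
have PU1 : \int[PU]_u (cst 1) u = 1.
  by rewrite integral_cst// mul1e; exact: probability_setT.
rewrite -(@leeD2rE _ 1)//.
have := @cond_gibbs s ms (mQ _ mes (fun z => expR_ge0 _)).
move: (cond_rel_entropy P Q PU) => D.
rewrite (eq_integral (fun u => \int[P u]_v (Num.max (t (u, v)) 0%R)%:E));
  last first.
  by move=> u _; apply: eq_integral => v _; rewrite (max_idPl (s0 _)).
move=> /le_trans; apply; rewrite -(addeA D); apply: (leeD2l D).
have -> : \int[PU]_u \int[P u]_v (Num.max (- s (u, v)) 0)%R%:E = 0.
  apply: integral0_eq => u _; apply: integral0_eq => v _; congr EFin.
  apply/max_idPr.
  by rewrite oppr_le0.
rewrite [leLHS]adde0.
have met' := mQ _ met (fun z => expR_ge0 _).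
have et0 u : 0 <= \int[Q u]_v (expR (t (u, v)))%:E.
  by apply: integral_ge0 => v _; rewrite lee_fin expR_ge0.
rewrite -[X in _ <= _ + X]PU1.
rewrite -[leRHS]ge0_integralD//.
apply: ge0_le_integralT => u.
  by apply: integral_ge0 => v _; rewrite lee_fin expR_ge0.
rewrite /= -[X in _ <= _ + X](Q1 u) -[Q u setT]mul1e.
rewrite -(integral_cst _ measurableT).
rewrite -ge0_integralD//; last first.
  by apply/measurable_EFinP; exact: (measurable_fun_pair2 _ met).
apply: ge0_le_integralT => v; first by rewrite lee_fin expR_ge0.
rewrite -EFinD lee_fin /s; move: (t (u, v)) => r.
by case: (leP r 0%R) => _; rewrite ?expR0; have := expR_ge0 r; lra.
Qed.

(** An exponential moment at most 1 is absorbed by the 1 in [cond_gibbs]; what remains says that the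
    mean of [t] is at most the divergence. *)
Lemma cond_gibbs_le1 (t : U * V -> R) : measurable_fun [set: U * V] t ->
  measurable_fun [set: U] (fun u => \int[Q u]_v (expR (t (u, v)))%:E) ->
  \int[PU]_u \int[Q u]_v (expR (t (u, v)))%:E <= 1 ->
  \int[PU]_u \int[P u]_v (Num.max (t (u, v)) 0%R)%:E <=
  cond_rel_entropy P Q PU +
    \int[PU]_u \int[P u]_v (Num.max (- t (u, v)) 0)%R%:E.
Proof.
move=> mt mQ E1; rewrite -(@leeD2rE _ 1)//.
apply: (le_trans (cond_gibbs mt mQ)); move: (cond_rel_entropy P Q PU) => D.
rewrite -(addeA D); apply: (leeD2l D).
by rewrite [leRHS]addeC; exact: leeD2r.
Qed.

(** Absolute continuity is encoded by the fibrewise bound [+oo * P u N_u <= D u + +oo * Q u N_u],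
    with [N_u] the section and [+oo * 0 = 0]. Its outer terms are measurable, so it integrates
    although [D] may not be; a finite total forces the [P]-mass to vanish. *)
Lemma cond_rel_entropy_dominates (N : set (U * V)) : measurable N ->
  cond_rel_entropy P Q PU < +oo ->
  measurable_fun [set: U] (fun u => Q u (xsection N u)) ->
  \int[PU]_u Q u (xsection N u) = 0 -> \int[PU]_u P u (xsection N u) = 0.
Proof.
move=> mN Doo mQ QN.
have mP : measurable_fun [set: U] (fun u => P u (xsection N u)).
  by apply: measurable_fun_xsection_finite_kernel; rewrite inE.
have : \int[PU]_u (+oo * P u (xsection N u)) <=
    cond_rel_entropy P Q PU + \int[PU]_u (+oo * Q u (xsection N u)).
  apply: ge0_le_lower_integralD.
  - exact: emeasurable_funM.
  - exact: emeasurable_funM.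
  - by move=> u; rewrite mule_ge0.
  - by move=> u; rewrite mule_ge0.
  - by move=> u; rewrite rel_entropy_ge0// prob_kernel.
  - move=> u; have [Q0|Q0] := eqVneq (Q u (xsection N u)) 0; last first.
      rewrite [X in _ + X]gt0_mulye; last by rewrite lt0e Q0/=.
      rewrite addey ?leey// -ltNye.
      by rewrite (@lt_le_trans _ _ 0)// rel_entropy_ge0// prob_kernel.
    rewrite Q0 mule0 adde0.
    have [Du|] := ltP (rel_entropy (P u) (Q u)) +oo; last first.
      by rewrite leye_eq => /eqP ->; rewrite leey.
    have [f [mf f0 Pf]] := rel_entropy_lty Du.
    rewrite Pf; last exact: measurable_xsection.
    rewrite (_ : \int[_]_(_ in _) _ = 0) ?mule0 ?rel_entropy_ge0 ?prob_kernel//.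
    rewrite (eq_integral (fun x => `|(f x)%:E|)); last first.
      by move=> v _; rewrite gee0_abs// lee_fin.
    apply: integral_abs_eq0 => //; first exact: measurable_xsection.
    exact/measurable_funTS/measurable_EFinP.
rewrite !ge0_integralZl// QN mule0 adde0 => h.
apply/eqP; apply: contraT => Pn0.
move: h; rewrite gt0_mulye; last by rewrite lt0e Pn0/= integral_ge0.
by rewrite leNgt Doo.
Qed.

End conditional_gibbs.

Lemma measurable_funV_gt0 d (T : measurableType d) (R : realType) (f : T -> R) :
  measurable_fun [set: T] f -> (forall x, (0 < f x)%R) ->
  measurable_fun [set: T] (fun x => (f x)^-1)%R.
Proof.
move=> mf f0; rewrite (_ : (fun x => _) = (fun x => f x `^ (-1))%R).
  exact: measurableT_comp (@measurable_powR R (-1)%R) mf.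
by apply/funext => x; rewrite powR_inv1// ltW.
Qed.

Lemma probability_integral_eq1 d (T : measurableType d) (R : realType)
    (mu : probability T R) (f : T -> \bar R) :
  (forall x, f x = 1) -> \int[mu]_x f x = 1.
Proof.
move=> f1; rewrite (eq_integral (cst 1)) => [|x _]; last exact: f1.
by rewrite integral_cst// mul1e; exact: probability_setT.
Qed.

(** * Densities of the output laws and one step of the iteration *)

Section klfun_div.
Context {R : realType}.
Local Open Scope ring_scope.

(** A change of reference measure: if [a] and [b] are the densities of a kernel and of its output
    law, the entropy integrand of [a / b] moves from the output law to the kernel. *)
Lemma klfun_div (a b : R) : 0 < a -> 0 < b ->
  b * klfun (a / b) = a * (ln (a / b) - 1 + b / a).
Proof.
move=> a0 b0; rewrite /klfun; move: (ln _) => l.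
by field; rewrite !gt_eqF.
Qed.

Lemma klfun_div_ge0 (a b : R) : 0 < a -> 0 < b ->
  0 <= ln (a / b) - 1 + b / a.
Proof.
move=> a0 b0; rewrite -(pmulr_rge0 _ a0) -klfun_div//.
by rewrite mulr_ge0 ?klfun_ge0 ?divr_ge0// ltW.
Qed.

End klfun_div.

Section mixture_density.
Context d d' (X : measurableType d) (Y : measurableType d') (R : realType).
Variables (PX : probability X R) (q : X * Y -> R).

(** When [q (x, .)] is the density of a kernel with respect to a fixed law, this is the density of
    the output law with respect to that same law. *)
Definition mixdens (y : Y) : \bar R := \int[PX]_x (q (x, y))%:E.

(* The value 1 on the null set where [mixdens] is infinite makes [mixdensr]
   positive everywhere, so that its inverse and logarithm are meaningful. *)
Definition mixdensr (y : Y) : R :=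
  if mixdens y == +oo then 1%R else fine (mixdens y).

Hypothesis mq : measurable_fun [set: X * Y] q.
Hypothesis q0 : forall z, (0 < q z)%R.

Let mqE : measurable_fun [set: X * Y] (EFin \o q).
Proof. exact/measurable_EFinP. Qed.

Let q0E z : 0 <= (q z)%:E. Proof. by rewrite lee_fin ltW. Qed.

Lemma measurable_mixdens : measurable_fun [set: Y] mixdens.
Proof. exact: (@measurable_fun_fubini_tonelli_G _ _ _ _ _ PX _ mqE). Qed.

Lemma mixdens_gt0 y : 0 < mixdens y.
Proof.
apply: integral_gt0 => [||x]; last by rewrite lte_fin.
  by rewrite [X in X != _]probability_setT onee_neq0.
by apply/measurable_EFinP; exact: measurable_fun_pair1.
Qed.

Lemma mixdensr_gt0 y : (0 < mixdensr y)%R.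
Proof.
rewrite /mixdensr; case: ifPn => // yoo.
by rewrite fine_gt0// mixdens_gt0 ltey.
Qed.

Lemma mixdensrE y : mixdens y != +oo -> mixdens y = (mixdensr y)%:E.
Proof.
move=> yoo; rewrite /mixdensr (negbTE yoo) fineK// ge0_fin_numE ?ltey//.
by rewrite ltW// mixdens_gt0.
Qed.

Lemma measurable_mixdensr : measurable_fun [set: Y] mixdensr.
Proof.
apply: measurable_fun_ifT => //; last first.
  exact: measurableT_comp measurable_mixdens.
apply: (measurable_fun_bool true).
rewrite [X in measurable X](_ : _ = [set: Y] `&` mixdens @^-1` [set +oo]).
  exact: measurable_mixdens.
by apply/seteqP; split => y /= [_ /eqP].
Qed.

Lemma measurable_mixdens_oo : measurable [set y | mixdens y = +oo].
Proof.
rewrite -[X in measurable X]setTI.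
exact: (measurable_mixdens measurableT (emeasurable_set1 +oo)).
Qed.

Lemma integral_mixdensr (V : probability Y R) (g : Y -> \bar R) :
  V [set y | mixdens y = +oo] = 0 ->
  (forall y, 0 <= g y) -> measurable_fun [set: Y] g ->
  \int[V]_y ((mixdensr y)%:E * g y) = \int[V]_y (mixdens y * g y).
Proof.
move=> V0 g0 mg; apply: ge0_ae_eq_integral => //.
- apply: emeasurable_funM => //; apply/measurable_EFinP.
  exact: measurable_mixdensr.
- by apply: emeasurable_funM => //; exact: measurable_mixdens.
- by move=> y _; rewrite mule_ge0// lee_fin ltW// mixdensr_gt0.
- by move=> y _; rewrite mule_ge0// ltW// mixdens_gt0.
- exists [set y | mixdens y = +oo]; split => //.
    exact: measurable_mixdens_oo.
  move=> y /= h; apply: contrapT => /eqP yoo; apply: h => _.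
  by rewrite (mixdensrE yoo).
Qed.

(** By Tonelli the integral over [x] turns the ratio into [h / h], whatever [V] is. This freedom
    lets the densities of an iterate be tested under the optimal output law. *)
Lemma integral_div_mixdensr (V : probability Y R) :
  V [set y | mixdens y = +oo] = 0 ->
  \int[PX]_x \int[V]_y (q (x, y) / mixdensr y)%:E = 1.
Proof.
move=> V0.
have mh := measurable_mixdensr.
have mhV : measurable_fun [set: Y] (fun y => (mixdensr y)^-1)%R.
  exact: (measurable_funV_gt0 mh mixdensr_gt0).
have h0 y : 0 <= ((mixdensr y)^-1)%:E.
  by rewrite lee_fin invr_ge0 ltW// mixdensr_gt0.
rewrite (@fubini_tonelli _ _ _ _ _ PX V
    (fun z => (q z / mixdensr z.2)%:E)); last 2 first.
- apply/measurable_EFinP; apply: measurable_funM => //.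
  exact: (measurableT_comp mhV).
- by move=> z; rewrite EFinM mule_ge0.
transitivity (\int[V]_y (mixdens y * ((mixdensr y)^-1)%:E)).
  apply: eq_integral => y _; rewrite /mixdens -ge0_integralZr//.
  by apply/measurable_EFinP; exact: measurable_fun_pair1.
rewrite -integral_mixdensr//; last exact/measurable_EFinP.
apply: probability_integral_eq1 => y.
by rewrite -EFinM mulfV// gt_eqF// mixdensr_gt0.
Qed.

End mixture_density.

Section density_step.
Context d d' (X : measurableType d) (Y : measurableType d') (R : realType).
Variables (PX : probability X R) (W W' : probability Y R).
Variables (q : X * Y -> R) (K : R.-pker X ~> Y).
Hypothesis mq : measurable_fun [set: X * Y] q.
Hypothesis q0 : forall z, (0 < q z)%R.
Hypothesis KE : forall x A, measurable A ->
  K x A = \int[W]_(y in A) (q (x, y))%:E.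
Hypothesis W'E : forall A, measurable A -> W' A = mixture PX K A.

Local Notation h := (mixdensr PX q).

Let mqx x : measurable_fun [set: Y] (fun y => q (x, y)).
Proof. exact: measurable_fun_pair2. Qed.

Let h_gt0 := mixdensr_gt0 PX mq q0.
Let mh := measurable_mixdensr PX mq q0.

Lemma integral_step_kernel x (g : Y -> \bar R) : (forall y, 0 <= g y) ->
  measurable_fun [set: Y] g ->
  \int[K x]_y g y = \int[W]_y ((q (x, y))%:E * g y).
Proof.
move=> g0 mg; apply: integral_density => //; last by move=> A; exact: KE.
by move=> y; exact: ltW.
Qed.

Lemma integral_step_mixture (g : Y -> \bar R) : (forall y, 0 <= g y) ->
  measurable_fun [set: Y] g -> \int[W']_y g y = \int[PX]_x \int[K x]_y g y.
Proof.
move=> g0 mg; rewrite -integral_mixture//.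
by apply: eq_measure_integral => A mA _; exact: W'E.
Qed.

Let integral_next_mixdens (g : Y -> \bar R) : (forall y, 0 <= g y) ->
  measurable_fun [set: Y] g ->
  \int[W']_y g y = \int[W]_y (mixdens PX q y * g y).
Proof.
move=> g0 mg; rewrite integral_step_mixture//.
under eq_integral do rewrite integral_step_kernel//.
rewrite (@fubini_tonelli _ _ _ _ _ PX W (fun z => (q z)%:E * g z.2)).
- apply: eq_integral => y _; rewrite /mixdens -ge0_integralZr//.
    by apply/measurable_EFinP; exact: measurable_fun_pair1.
  by move=> x _; rewrite lee_fin ltW.
- apply: emeasurable_funM; first exact/measurable_EFinP.
  exact: (measurableT_comp mg).
- by move=> z; rewrite mule_ge0// lee_fin ltW.
Qed.

(** The density integrates to 1 under [W], because the next output law is a probability, and so is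
    finite almost everywhere. *)
Lemma mixdens_oo_null : W [set y | mixdens PX q y = +oo] = 0.
Proof.
have md := measurable_mixdens PX mq q0.
have : \int[W]_y mixdens PX q y = 1.
  rewrite (eq_integral (fun y => mixdens PX q y * 1)); last first.
    by move=> y _; rewrite mule1.
  by rewrite -integral_next_mixdens//; exact: probability_integral_eq1.
move=> I1.
have : W.-integrable setT (mixdens PX q).
  apply/integrableP; split => //.
  rewrite (eq_integral (mixdens PX q)) ?I1 ?ltry// => y _.
  by rewrite gee0_abs// ltW// mixdens_gt0.
move=> /(integrable_ae measurableT)[N [mN N0 sN]].
apply: (subset_measure0 _ mN _ N0); first exact: measurable_mixdens_oo.
by move=> y /= yoo; apply: sN => /= /(_ Logic.I); rewrite yoo.
Qed.

Lemma integral_step (g : Y -> \bar R) : (forall y, 0 <= g y) ->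
  measurable_fun [set: Y] g -> \int[W']_y g y = \int[W]_y ((h y)%:E * g y).
Proof.
move=> g0 mg; rewrite integral_mixdensr//; last exact: mixdens_oo_null.
exact: integral_next_mixdens.
Qed.

(** Under [K x] the factor [1 / q] returns to [W], and [h] then leads from [W] to [W'], where [q']
    has mass 1. *)
Lemma integral_step_ratio (q' : X * Y -> R) :
  measurable_fun [set: X * Y] q' -> (forall z, (0 <= q' z)%R) ->
  (forall x, \int[W']_y (q' (x, y))%:E = 1) ->
  \int[PX]_x \int[K x]_y (q' (x, y) * h y / q (x, y))%:E = 1.
Proof.
move=> mq' q'0 W'q'; apply: probability_integral_eq1 => x; rewrite integral_step_kernel//.
- rewrite -(W'q' x) integral_step//.
  + apply: eq_integral => y _; rewrite -!EFinM; congr EFin.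
    by have := q0 (x, y) => qxy; field; rewrite gt_eqF.
  + by move=> y; rewrite lee_fin.
  + by apply/measurable_EFinP; exact: measurable_fun_pair2.
- by move=> y; rewrite lee_fin !mulr_ge0// ?invr_ge0 ltW.
- apply/measurable_EFinP; apply: measurable_funM.
    by apply: measurable_funM => //; exact: measurable_fun_pair2.
  exact: (measurable_funV_gt0 (mqx x) (fun y => q0 (x, y))).
Qed.

Lemma integral_step_inv : \int[PX]_x \int[K x]_y ((h y)^-1)%:E = 1.
Proof.
have hV0 y : 0 <= ((h y)^-1)%:E by rewrite lee_fin invr_ge0 ltW.
have mhV : measurable_fun [set: Y] (fun y => ((h y)^-1)%:E).
  exact/measurable_EFinP/(measurable_funV_gt0 mh h_gt0).
rewrite -integral_step_mixture// integral_step//.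
by apply: probability_integral_eq1 => y; rewrite -EFinM mulfV// gt_eqF.
Qed.

(** [q / h] is the density of [K x] with respect to the new output law. The correction [- 1 + h / q]
    has mean zero and makes the integrand pointwise nonnegative. *)
Lemma mutual_info_step : mutual_info PX K =
  \int[PX]_x \int[K x]_y (ln (q (x, y) / h y) - 1 + h y / q (x, y))%:E.
Proof.
have mqh x : measurable_fun [set: Y] (fun y => q (x, y) / h y)%R.
  by apply: measurable_funM => //; exact: (measurable_funV_gt0 mh h_gt0).
have qh0 x y : (0 < q (x, y) / h y)%R by rewrite divr_gt0.
have eq_mix (g : Y -> \bar R) (A : set Y) :
    \int[mixture PX K]_(y in A) g y = \int[W']_(y in A) g y.
  by apply: eq_measure_integral => B mB _; exact/esym/W'E.
rewrite /mutual_info /cond_rel_entropy; apply: eq_integral => x _.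
rewrite (@rel_entropyE _ _ _ _ _ (fun y => q (x, y) / h y)%R).
- rewrite eq_mix integral_step//; last 2 first.
  + by move=> y; rewrite lee_fin klfun_ge0// ltW.
  + by apply/measurable_EFinP; exact: measurableT_comp measurable_klfun (mqh x).
  rewrite integral_step_kernel.
  + by apply: eq_integral => y _; rewrite -!EFinM; congr EFin; exact: klfun_div.
  + by move=> y; rewrite lee_fin; exact: klfun_div_ge0.
  + apply/measurable_EFinP; apply: measurable_funD.
      by apply: measurable_funB => //;
        exact: measurableT_comp (@measurable_ln R) (mqh x).
    apply: measurable_funM => //.
    exact: (measurable_funV_gt0 (mqx x) (fun y => q0 (x, y))).
- exact: prob_kernel.
- exact: probability_setT.
- split => [//||A mA]; first by move=> y; exact: ltW.
  rewrite eq_mix KE// integral_mkcond [RHS]integral_mkcond integral_step//.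
  + apply: eq_integral => y _; rewrite !patchE.
    case: ifPn => _; last by rewrite mule0.
    rewrite -EFinM; congr EFin.
    by have := h_gt0 y => hy; field; rewrite gt_eqF.
  + by apply: erestrict_ge0 => y _; rewrite lee_fin ltW.
  + apply/(measurable_restrictT _ _).1 => //.
    exact/measurable_funTS/measurable_EFinP.
Qed.

End density_step.

(** * Comparing integrals without integrability assumptions *)

Section probability_integrals.
Context d (T : measurableType d) (R : realType).
Implicit Type M : probability T R.

(** Only the finite constant [c] is cancelled, so the integrals of [a] and [b] may be infinite. *)
Lemma integral_le_normalized M (a b r : T -> R) (c : R) :
  measurable_fun [set: T] a -> measurable_fun [set: T] b ->
  measurable_fun [set: T] r ->
  (forall z, (0 <= a z)%R) -> (forall z, (0 <= b z)%R) ->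
  (forall z, (0 <= r z)%R) -> (0 <= c)%R -> \int[M]_z (r z)%:E = c%:E ->
  (forall z, (a z + c <= b z + r z)%R) ->
  \int[M]_z (a z)%:E <= \int[M]_z (b z)%:E.
Proof.
move=> ma mb mr a0 b0 r0 c0 Ir abr.
have Ic : \int[M]_z (cst c%:E) z = c%:E.
  rewrite integral_cst//; transitivity (c%:E * 1); last by rewrite mule1.
  by congr (_ * _); exact: probability_setT.
have ma' : measurable_fun [set: T] (fun z => (a z)%:E) by exact/measurable_EFinP.
have mb' : measurable_fun [set: T] (fun z => (b z)%:E) by exact/measurable_EFinP.
have mr' : measurable_fun [set: T] (fun z => (r z)%:E) by exact/measurable_EFinP.
have a0' z : [set: T] z -> 0 <= (a z)%:E by rewrite lee_fin.
have b0' z : [set: T] z -> 0 <= (b z)%:E by rewrite lee_fin.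
have r0' z : [set: T] z -> 0 <= (r z)%:E by rewrite lee_fin.
have c0' z : [set: T] z -> 0 <= cst c%:E z by rewrite lee_fin.
rewrite -(@leeD2rE _ c%:E)// -[X in _ + X <= _]Ic -[X in _ <= _ + X]Ir.
rewrite -[leLHS]ge0_integralD// -[leRHS]ge0_integralD//.
apply: ge0_le_integralT => z; rewrite /= -!EFinD lee_fin ?addr_ge0//.
Qed.

Lemma integral_four M (r1 r2 r3 r4 : T -> R) (c : R) :
  measurable_fun [set: T] r1 -> measurable_fun [set: T] r2 ->
  measurable_fun [set: T] r3 -> measurable_fun [set: T] r4 ->
  (forall z, (0 <= r1 z)%R) -> (forall z, (0 <= r2 z)%R) ->
  (forall z, (0 <= r3 z)%R) -> (forall z, (0 <= r4 z)%R) -> (0 <= c)%R ->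
  \int[M]_z (r1 z)%:E = 1 -> \int[M]_z (r2 z)%:E = 1 ->
  \int[M]_z (r3 z)%:E = 1 -> \int[M]_z (r4 z)%:E = 1 ->
  \int[M]_z (r1 z + r2 z + c * (r3 z + r4 z))%:E = (2 + 2 * c)%:E.
Proof.
move=> m1 m2 m3 m4 p1 p2 p3 p4 c0 I1 I2 I3 I4.
have ? z : 0 <= (r1 z)%:E by rewrite lee_fin.
have ? z : 0 <= (r2 z)%:E by rewrite lee_fin.
have ? z : 0 <= (r3 z)%:E by rewrite lee_fin.
have ? z : 0 <= (r4 z)%:E by rewrite lee_fin.
have ? : measurable_fun [set: T] (fun z => (r1 z)%:E) by exact/measurable_EFinP.
have ? : measurable_fun [set: T] (fun z => (r2 z)%:E) by exact/measurable_EFinP.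
have ? : measurable_fun [set: T] (fun z => (r3 z)%:E) by exact/measurable_EFinP.
have ? : measurable_fun [set: T] (fun z => (r4 z)%:E) by exact/measurable_EFinP.
transitivity (\int[M]_z
    (((r1 z)%:E + (r2 z)%:E) + c%:E * ((r3 z)%:E + (r4 z)%:E))).
  by apply: eq_integral.
rewrite ge0_integralD//.
- rewrite ge0_integralD// ge0_integralZl//.
  + rewrite ge0_integralD// I1 I2 I3 I4.
    by transitivity ((1 + 1 + c * (1 + 1))%:E) => //; congr EFin; ring.
  + exact: emeasurable_funD.
  + by move=> z _; rewrite adde_ge0.
- by move=> z _; rewrite adde_ge0.
- exact: emeasurable_funD.
- by move=> z _; rewrite mule_ge0 ?adde_ge0.
- by apply: emeasurable_funM => //; exact: emeasurable_funD.
Qed.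

(** Moving negative parts across gives an identity between nonnegative integrals whose side with the
    positive parts is finite. The weighted negative parts are then finite too, and cancel against
    those in the bounds. *)
Lemma integral_le_sum_bounds M (n : nat) (w : 'I_n -> R) (t : 'I_n -> T -> R)
    (L D : T -> R) (b : 'I_n -> \bar R) :
  (forall i, measurable_fun [set: T] (t i)) ->
  measurable_fun [set: T] L -> measurable_fun [set: T] D ->
  (forall i, (0 <= w i)%R) -> (forall z, (0 <= L z)%R) ->
  (forall z, (0 <= D z)%R) -> (forall i, 0 <= b i) ->
  (forall z, L z = \sum_(i < n) w i * t i z + D z)%R ->
  (forall i, \int[M]_z (Num.max (t i z) 0%R)%:E < +oo) ->
  (forall i, \int[M]_z (Num.max (t i z) 0%R)%:E <=
    b i + \int[M]_z (Num.max (- t i z) 0%R)%:E) ->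
  \int[M]_z (D z)%:E < +oo ->
  \int[M]_z (L z)%:E <= \sum_(i < n) (w i)%:E * b i + \int[M]_z (D z)%:E.
Proof.
move=> mt mL mD w0 L0 D0 b0 LE Aoo AB Doo.
have tp0 i z : 0 <= (Num.max (t i z) 0%R)%:E by rewrite lee_fin le_max lexx orbT.
have tn0 i z : 0 <= (Num.max (- t i z) 0%R)%:E.
  by rewrite lee_fin le_max lexx orbT.
have mtp i : measurable_fun [set: T] (fun z => (Num.max (t i z) 0%R)%:E).
  by apply/measurable_EFinP; exact: measurable_maxr.
have mtn i : measurable_fun [set: T] (fun z => (Num.max (- t i z) 0%R)%:E).
  apply/measurable_EFinP; apply: measurable_maxr => //.
  exact: measurableT_comp.
have mL' : measurable_fun [set: T] (fun z => (L z)%:E) by exact/measurable_EFinP.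
have mD' : measurable_fun [set: T] (fun z => (D z)%:E) by exact/measurable_EFinP.
pose A i := \int[M]_z (Num.max (t i z) 0%R)%:E.
pose B i := \int[M]_z (Num.max (- t i z) 0%R)%:E.
have A0 i : 0 <= A i by exact: integral_ge0.
have B0 i : 0 <= B i by exact: integral_ge0.
have sumE (s : 'I_n -> T -> R) : (forall i z, 0 <= (s i z)%:E) ->
    (forall i, measurable_fun [set: T] (fun z => (s i z)%:E)) ->
    \sum_(i < n) (w i)%:E * \int[M]_z (s i z)%:E =
    \int[M]_z (\sum_(i < n) w i * s i z)%R%:E.
  move=> s0 ms.
  transitivity (\int[M]_z \sum_(i < n) ((w i)%:E * (s i z)%:E)).
    rewrite ge0_integral_sum//.
    - by apply: eq_bigr => i _; rewrite ge0_integralZl// lee_fin.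
    - by move=> i; exact: emeasurable_funM.
    - by move=> i z _; rewrite mule_ge0// lee_fin.
  by apply: eq_integral => z _; rewrite -sumEFin; apply: eq_bigr.
have L0' z : 0 <= (L z)%:E by rewrite lee_fin.
have D0' z : 0 <= (D z)%:E by rewrite lee_fin.
have ws0 (s : 'I_n -> T -> R) z : (forall i z, 0 <= (s i z)%:E) ->
    0 <= (\sum_(i < n) w i * s i z)%R%:E.
  move=> s0; rewrite lee_fin sumr_ge0// => i _.
  by rewrite mulr_ge0// -lee_fin; exact: s0.
have mws (s : 'I_n -> T -> R) :
    (forall i, measurable_fun [set: T] (fun z => (s i z)%:E)) ->
    measurable_fun [set: T] (fun z => (\sum_(i < n) w i * s i z)%R%:E).
  move=> ms; apply/measurable_EFinP; apply: measurable_sum => i.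
  by apply: measurable_funM => //; have /measurable_EFinP := ms i.
have key : \int[M]_z (L z)%:E + \sum_(i < n) (w i)%:E * B i =
    \sum_(i < n) (w i)%:E * A i + \int[M]_z (D z)%:E.
  rewrite /A /B !sumE//.
  have mn := mws _ mtn; have mp := mws _ mtp.
  have n0 z := ws0 _ z tn0; have p0 z := ws0 _ z tp0.
  rewrite -[LHS]ge0_integralD// -[RHS]ge0_integralD//.
  apply: eq_integral => z _; rewrite -!EFinD LE; congr EFin.
  rewrite addrAC -big_split/=; congr (_ + _)%R; apply: eq_bigr => i _.
  by rewrite -mulrDr -{1}[t i z]posr_negr subrK.
have wB0 : 0 <= \sum_(i < n) (w i)%:E * B i.
  by apply: sume_ge0 => i _; rewrite mule_ge0// lee_fin.
have wBfin : \sum_(i < n) (w i)%:E * B i \is a fin_num.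
  rewrite ge0_fin_numE//; apply: (@le_lt_trans _ _
    (\int[M]_z (L z)%:E + \sum_(i < n) (w i)%:E * B i)).
    by rewrite leeDr// integral_ge0// => z _; rewrite lee_fin.
  rewrite key lte_add_pinfty//; apply: lte_sum_pinfty => i _.
  by apply: lte_mul_pinfty; [rewrite lee_fin| |exact: Aoo].
rewrite -(leeD2rE _ _ wBfin) key addeAC.
apply: (@leeD2r _ (\int[M]_z (D z)%:E)); rewrite -big_split/=.
apply: lee_sum => i _.
rewrite -ge0_muleDr//; apply: lee_wpmul2l; first by rewrite lee_fin.
exact: AB.
Qed.

End probability_integrals.

(** * Composing the densities along the iteration *)

Section density_chain.
Context d (Y : measurableType d) (R : realType).
Variables (W : nat -> probability Y R) (h : nat -> Y -> R).
Hypothesis mh : forall k, measurable_fun [set: Y] (h k).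
Hypothesis h_gt0 : forall k y, (0 < h k y)%R.
Hypothesis WE : forall k (g : Y -> \bar R), (forall y, 0 <= g y) ->
  measurable_fun [set: Y] g ->
  \int[W k.+1]_y g y = \int[W k]_y ((h k y)%:E * g y).

(** The log-density of [W n] with respect to [W 0]. *)
Definition log_chain n (y : Y) : R := (\sum_(k < n) ln (h k y))%R.

Lemma measurable_log_chain n : measurable_fun [set: Y] (log_chain n).
Proof.
by apply: measurable_sum => k; exact: measurableT_comp (@measurable_ln R) (mh k).
Qed.

Lemma integral_chain n (g : Y -> \bar R) : (forall y, 0 <= g y) ->
  measurable_fun [set: Y] g ->
  \int[W n]_y g y = \int[W 0%N]_y ((expR (log_chain n y))%:E * g y).
Proof.
elim: n g => [|n IH] g g0 mg.
  by apply: eq_integral => y _; rewrite /log_chain big_ord0 expR0 mul1e.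
rewrite WE// IH.
- apply: eq_integral => y _; rewrite /log_chain big_ord_recr/= expRD lnK ?posrE//.
  by rewrite EFinM muleA.
- by move=> y; rewrite mule_ge0// lee_fin ltW.
- by apply: emeasurable_funM => //; exact/measurable_EFinP.
Qed.

(** Each [h k] is positive everywhere, so domination also runs backwards along the chain. This
    direction brings the null sets of step [n] back to the initial law. *)
Lemma chain_null n (N : set Y) : measurable N -> W n N = 0 -> W 0%N N = 0.
Proof.
move=> mN; elim: n => // n IH WN; apply: IH; move: WN.
have mI : measurable_fun [set: Y] (fun y => (\1_N y)%:E : \bar R).
  exact/measurable_EFinP/measurable_indic.
rewrite -[in X in X -> _](setIT N) -integral_indic// WE//.
move=> I0.
have : \int[W n]_y `|(h n y)%:E * (\1_N y)%:E| = 0.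
  rewrite -[RHS]I0; apply: eq_integral => y _.
  rewrite gee0_abs// mule_ge0// lee_fin//.
  exact: ltW.
move/ae_eq_integral_abs => /(_ measurableT) [|N' [mN' N'0 sN']].
  by apply: emeasurable_funM => //; exact/measurable_EFinP.
apply: (subset_measure0 mN mN' _ N'0) => y Ny; apply: sN' => /= /(_ Logic.I).
rewrite indicE mem_set// mule1 => -[] /eqP.
by rewrite gt_eqF.
Qed.

End density_chain.

Lemma integral_density_null d (T : measurableType d) (R : realType)
    (Q m : {measure set T -> \bar R}) (f : T -> R) (g : T -> \bar R) :
  is_density m Q f -> (forall x, 0 <= g x) -> measurable_fun [set: T] g ->
  \int[Q]_x g x = 0 -> \int[m]_x g x = 0.
Proof.
move=> [mf f0 mE] g0 mg Ig; rewrite (integral_density mf f0 mE)//.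
have : \int[Q]_x `|g x| = 0.
  by rewrite -[RHS]Ig; apply: eq_integral => x _; rewrite gee0_abs.
move/ae_eq_integral_abs => /(_ measurableT mg) [N [mN N0 sN]].
rewrite (ge0_ae_eq_integral (g := cst 0)) ?integral0//.
- by apply: emeasurable_funM => //; exact/measurable_EFinP.
- by move=> x _; rewrite mule_ge0// lee_fin.
- exists N; split => // x /= h; apply: sN => /= gx; apply: h => _.
  by rewrite gx// mule0.
Qed.

(** * Exponential of an arithmetic mean *)

Section geometric_mean.
Context {R : realType}.
Local Open Scope ring_scope.

Lemma expR_mean_le (n : nat) (a : 'I_n.+1 -> R) :
  expR (n.+1%:R^-1 * \sum_i a i) <= n.+1%:R^-1 * \sum_i expR (a i).
Proof.
set m := n.+1%:R^-1 * _.
have n0 : (0 : R) < n.+1%:R by rewrite ltr0n.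
rewrite -(ler_pM2l n0) mulrA mulfV ?gt_eqF// mul1r.
(* Tangent line of [expR] at the mean [m]: the deviations [a i - m] sum to zero. *)
have -> : n.+1%:R * expR m = \sum_(i < n.+1) (expR m * (1 + (a i - m))).
  rewrite -mulr_sumr mulrC big_split/= sumr_const card_ord sumrB.
  rewrite sumr_const card_ord -[m *+ _]mulr_natl /m mulrA mulfV ?gt_eqF// mul1r.
  by rewrite subrr addr0.
apply: ler_sum => i _.
rewrite -[X in _ <= expR X](subrK m) expRD mulrC ler_pM2r ?expR_gt0//.
exact: expR_ge1Dx.
Qed.

End geometric_mean.

(** Allows a single Gibbs inequality to treat the average of [n+1] normalized exponents at the price
    of one divergence. *)
Lemma integral_expR_mean_le1 d d' (X : measurableType d) (Y : measurableType d')
    (R : realType) (PX : probability X R) (V : probability Y R) (n : nat)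
    (a : 'I_n.+1 -> X * Y -> R) :
  (forall i, measurable_fun [set: X * Y] (a i)) ->
  (forall i, \int[PX]_x \int[V]_y (expR (a i (x, y)))%:E = 1) ->
  \int[PX]_x \int[V]_y (expR (n.+1%:R^-1 * \sum_i a i (x, y)))%:E <= 1.
Proof.
move=> ma Ia.
have me i : measurable_fun [set: X * Y] (fun z => (expR (a i z))%:E).
  by apply/measurable_EFinP; exact: measurableT_comp.
have e0 i z : 0 <= (expR (a i z))%:E by rewrite lee_fin expR_ge0.
have meV i : measurable_fun [set: X] (fun x => \int[V]_y (expR (a i (x, y)))%:E).
  exact: (@measurable_fun_fubini_tonelli_F _ _ _ _ _ V _ (me i)).
have meY i x : measurable_fun [set: Y] (fun y => (expR (a i (x, y)))%:E).
  exact: (measurable_fun_pair2 _ (me i)).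
have n0 : 0 <= (n.+1%:R^-1)%:E :> \bar R by rewrite lee_fin invr_ge0.
apply: (@le_trans _ _ (\int[PX]_x \int[V]_y
    ((n.+1%:R^-1)%:E * \sum_(i < n.+1) (expR (a i (x, y)))%:E))).
  apply: ge0_le_integralT => x.
    by apply: integral_ge0 => y _; rewrite lee_fin expR_ge0.
  apply: ge0_le_integralT => y; first by rewrite lee_fin expR_ge0.
  by rewrite sumEFin -EFinM lee_fin expR_mean_le.
under eq_integral => x _.
  rewrite ge0_integralZl//; last 2 first.
  - exact: emeasurable_sum.
  - by move=> y _; exact: sume_ge0.
  rewrite ge0_integral_sum//.
  over.
rewrite /= ge0_integralZl//; last 2 first.
- exact: emeasurable_sum.
- by move=> x _; apply: sume_ge0 => i _; exact: integral_ge0.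
rewrite ge0_integral_sum//; last by move=> i x _; exact: integral_ge0.
under eq_bigr do rewrite Ia.
by rewrite sumEFin sumr_const card_ord -EFinM lee_fin mulVf.
Qed.

(** * The joint law of [(X, Y1, Y2)] and its marginals *)

Section joint_law.
Context d0 d1 d2 (X : measurableType d0) (Y1 : measurableType d1)
  (Y2 : measurableType d2) (R : realType).
Variables (PX : probability X R).
Variables (K1 : R.-pker X ~> Y1) (K2 : R.-pker (X * Y1) ~> Y2).

Local Notation M := (semidirect PX (mkproduct K1 K2)).

Lemma mkproductX x A B : measurable A -> measurable B ->
  mkproduct K1 K2 x (A `*` B) = \int[K1 x]_(y in A) K2 (x, y) B.
Proof.
move=> mA mB; have mAB : measurable (A `*` B) by exact: measurableX.
rewrite -[in LHS](setIT (A `*` B)) -integral_indic// integral_mkproduct.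
- rewrite [RHS]integral_mkcond; apply: eq_integral => y _; rewrite patchE.
  case: ifPn => yA.
    rewrite (eq_integral (fun z => (\1_B z)%:E)).
      by rewrite integral_indic// setIT.
    by move=> z _; rewrite !indicE in_setX/= yA.
  by apply: integral0_eq => z _; rewrite indicE in_setX/= (negbTE yA).
- by move=> z; rewrite lee_fin.
- exact/measurable_EFinP/measurable_indic.
Qed.

(** [is_cond_law] is agreement on rectangles, which determines a finite measure. *)
Lemma semidirect_cond_law (P1 : probability Y1 R) (P21 : R.-pker Y1 ~> Y2) :
  is_cond_law PX K1 K2 P1 P21 ->
  forall C, measurable C -> semidirect P1 P21 C = mixture PX (mkproduct K1 K2) C.
Proof.
move=> claw; apply: measure_unique_prod.
  by rewrite [X in X < _](probability_setT (semidirect P1 P21)) ltry.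
move=> A B mA mB; transitivity (\int[P1]_(y1 in A) P21 y1 B).
  exact: semidirectX.
rewrite claw//; apply: eq_integral => x _; exact/esym/mkproductX.
Qed.

Lemma integral_joint12 (g : X * Y1 -> \bar R) : (forall z, 0 <= g z) ->
  measurable_fun [set: X * Y1] g ->
  \int[M]_z g (z.1, z.2.1) = \int[PX]_x \int[K1 x]_y g (x, y).
Proof.
move=> g0 mg.
have mg' : measurable_fun [set: X * (Y1 * Y2)] (fun z => g (z.1, z.2.1)).
  apply: (measurableT_comp mg); apply: measurable_fun_pair => //.
  exact: measurableT_comp.
rewrite (@integral_semidirect _ _ _ _ _ PX (mkproduct K1 K2)
  (fun z => g (z.1, z.2.1)))//.
apply: eq_integral => x _; rewrite /=.
rewrite (@integral_mkproduct _ _ _ _ _ _ _ _ _ x (fun y => g (x, y.1)))//.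
  apply: eq_integral => y _ /=; rewrite integral_cst//.
  by rewrite -[RHS]mule1; congr (_ * _); exact: prob_kernel.
exact: (measurable_fun_pair2 _ mg').
Qed.

Lemma integral_joint123 (g : X * (Y1 * Y2) -> \bar R) : (forall z, 0 <= g z) ->
  measurable_fun [set: X * (Y1 * Y2)] g ->
  \int[M]_z g z =
  \int[PX]_x \int[K1 x]_y1 \int[K2 (x, y1)]_y2 g (x, (y1, y2)).
Proof.
move=> g0 mg; rewrite integral_semidirect//; apply: eq_integral => x _.
rewrite (@integral_mkproduct _ _ _ _ _ _ _ _ _ x (fun y => g (x, y)))//.
exact: (measurable_fun_pair2 _ mg).
Qed.

Lemma integral_joint1 (g : X -> \bar R) : (forall z, 0 <= g z) ->
  measurable_fun [set: X] g -> \int[M]_z g z.1 = \int[PX]_x g x.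
Proof.
move=> g0 mg; rewrite (@integral_semidirect _ _ _ _ _ _ _ (fun z => g z.1))//.
  apply: eq_integral => y _ /=; rewrite integral_cst//.
  rewrite -[RHS]mule1; congr (_ * _).
  exact: (@prob_kernel _ _ _ _ _ (mkproduct K1 K2) y).
exact: (measurableT_comp mg).
Qed.

Lemma integral_joint23 (g : Y1 * Y2 -> \bar R) : (forall z, 0 <= g z) ->
  measurable_fun [set: Y1 * Y2] g ->
  \int[M]_z g z.2 = \int[mixture PX (mkproduct K1 K2)]_y g y.
Proof.
move=> g0 mg; rewrite integral_mixture//.
rewrite (@integral_semidirect _ _ _ _ _ _ _ (fun z => g z.2))//.
exact: (measurableT_comp mg).
Qed.

Lemma integral_joint2 (g : Y1 -> \bar R) : (forall z, 0 <= g z) ->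
  measurable_fun [set: Y1] g ->
  \int[M]_z g z.2.1 = \int[mixture PX K1]_y g y.
Proof.
move=> g0 mg; rewrite integral_mixture//.
rewrite (@integral_joint12 (fun z => g z.2))//.
exact: (measurableT_comp mg).
Qed.

End joint_law.

(** * The normalizers and the densities of the updated kernels *)

Section beta_lemmas.
Context dX d1 d2 (X : measurableType dX) (Y1 : measurableType d1)
  (Y2 : measurableType d2) (R : realType).
Variables (dist1 : X -> Y1 -> R) (dist2 : X -> Y2 -> R).
Hypothesis hd1m : measurable_fun [set: X * Y1] (fun p => dist1 p.1 p.2).
Hypothesis hd2m : measurable_fun [set: X * Y2] (fun p => dist2 p.1 p.2).
Hypothesis hd1 : forall x y1, (0 <= dist1 x y1)%R.
Hypothesis hd2 : forall x y2, (0 <= dist2 x y2)%R.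
Variables (nu1 lam1 lam2 : R).
Hypotheses (hnu1 : (0 < nu1)%R) (hlam1 : (0 < lam1)%R) (hlam2 : (0 < lam2)%R).
Variables (P1 : probability Y1 R) (P21 : R.-pker Y1 ~> Y2).

Local Notation b2 := (beta2 dist2 lam2 P21).
Local Notation b1 := (beta1 dist1 dist2 nu1 lam1 lam2 P1 P21).

Let nu1_gt0 : (0 < 1 + nu1)%R. Proof. by rewrite addr_gt0. Qed.

Let e2 (x : X) (y2 : Y2) : R := expR (- (lam2 * dist2 x y2)).

Let me2 x : measurable_fun [set: Y2] (e2 x).
Proof.
apply: measurableT_comp => //; apply: measurableT_comp => //.
by apply: measurable_funM => //; exact: (measurable_fun_pair2 x hd2m).
Qed.

(** The distortions are nonnegative, so the integrands defining [beta2] and [beta1] lie in [(0, 1]].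
    Hence [fine] loses nothing, and both normalizers may be inverted and have nonpositive
    logarithm. *)
Let fin_unit d (T : measurableType d) (mu : {measure set T -> \bar R})
    (f : T -> R) : mu setT = 1 ->
  measurable_fun [set: T] f -> (forall x, (0 < f x)%R) ->
  (forall x, (f x <= 1)%R) ->
  [/\ \int[mu]_x (f x)%:E = (fine (\int[mu]_x (f x)%:E))%:E,
      (0 < fine (\int[mu]_x (f x)%:E))%R &
      (fine (\int[mu]_x (f x)%:E) <= 1)%R].
Proof.
move=> mu1 mf f0 f1.
have mF : measurable_fun [set: T] (fun x => (f x)%:E) by exact/measurable_EFinP.
have I0 : 0 < \int[mu]_x (f x)%:E.
  by apply: integral_gt0; rewrite ?mu1 ?onee_neq0// => x; rewrite lte_fin.
have I1 : \int[mu]_x (f x)%:E <= 1.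
  rewrite -[leRHS]mul1e -{2}mu1 -(integral_cst mu measurableT).
  by apply: ge0_le_integralT => x; rewrite lee_fin// ltW.
have If : \int[mu]_x (f x)%:E \is a fin_num.
  by rewrite ge0_fin_numE ?(le_lt_trans I1) ?ltry// ltW.
by split; rewrite -?lte_fin -?lee_fin fineK.
Qed.

Let beta2P x y1 : [/\ \int[P21 y1]_y2 (e2 x y2)%:E = (b2 x y1)%:E,
  (0 < b2 x y1)%R & (b2 x y1 <= 1)%R].
Proof.
apply: fin_unit => //; [exact: prob_kernel|move=> y2|move=> y2].
  by rewrite expR_gt0.
by rewrite -[leRHS]expR0 ler_expR oppr_le0 mulr_ge0// ltW.
Qed.

Lemma beta2_gt0 x y1 : (0 < b2 x y1)%R.
Proof. by have [] := beta2P x y1. Qed.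

Lemma beta2_le1 x y1 : (b2 x y1 <= 1)%R.
Proof. by have [] := beta2P x y1. Qed.

Lemma measurable_beta2 : measurable_fun [set: X * Y1] (fun z => b2 z.1 z.2).
Proof.
apply: measurableT_comp => //.
apply: (@measurable_fun_integral_finite_kernel _ _ (X * Y1)%type Y2 R
  (fun p => (expR (- (lam2 * dist2 p.1.1 p.2)))%:E)
  (kernel.kernel_snd P21)).
  by move=> z; rewrite lee_fin expR_ge0.
apply/measurable_EFinP; apply: measurableT_comp => //.
apply: measurableT_comp => //; apply: measurable_funM => //.
apply: (@measurableT_comp _ _ _ _ _ _ (fun p : X * Y2 => dist2 p.1 p.2)
  _ (fun p : (X * Y1) * Y2 => (p.1.1, p.2))) => //.
by apply: measurable_fun_pair => //; exact: measurableT_comp.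
Qed.

Let e1 (x : X) (y1 : Y1) : R :=
  (b2 x y1 `^ (1 + nu1)^-1 * expR (- (lam1 / (1 + nu1) * dist1 x y1)))%R.

Let me1 : measurable_fun [set: X * Y1] (fun z => e1 z.1 z.2).
Proof.
apply: measurable_funM.
  apply: (measurableT_comp (@measurable_powR R (1 + nu1)^-1)).
  exact: measurable_beta2.
apply: measurableT_comp => //; apply: measurableT_comp => //.
exact: measurable_funM.
Qed.

Let e1_gt0 x y1 : (0 < e1 x y1)%R.
Proof. by rewrite mulr_gt0 ?expR_gt0// powR_gt0// beta2_gt0. Qed.

Let beta1P x : [/\ \int[P1]_y1 (e1 x y1)%:E = (b1 x)%:E,
  (0 < b1 x)%R & (b1 x <= 1)%R].
Proof.
apply: fin_unit => //; first exact: probability_setT.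
  exact: (measurable_fun_pair2 x me1).
move=> y1; rewrite /e1 mulr_ile1 ?powR_ge0 ?expR_ge0//.
  rewrite /powR gt_eqF ?beta2_gt0// -[leRHS]expR0 ler_expR.
  apply: mulr_ge0_le0; first by rewrite invr_ge0 ltW.
  by rewrite ln_le0// beta2_le1.
by rewrite -[leRHS]expR0 ler_expR oppr_le0 mulr_ge0// divr_ge0// ltW.
Qed.

Lemma beta1_gt0 x : (0 < b1 x)%R.
Proof. by have [] := beta1P x. Qed.

Lemma beta1_le1 x : (b1 x <= 1)%R.
Proof. by have [] := beta1P x. Qed.

Lemma measurable_beta1 : measurable_fun [set: X] b1.
Proof.
apply: measurableT_comp => //.
apply: (@measurable_fun_fubini_tonelli_F _ _ _ _ _ P1
  (fun z => (e1 z.1 z.2)%:E)); first exact/measurable_EFinP.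
by move=> z; rewrite lee_fin ltW.
Qed.

(** [dens1] and [dens2] are the two Radon-Nikodym derivatives of the update; [dens] is the density
    of the updated kernel to the pair with respect to the old joint output law. *)
Definition dens1 (z : X * Y1) : R :=
  (b2 z.1 z.2 `^ (1 + nu1)^-1 *
    expR (- (lam1 / (1 + nu1) * dist1 z.1 z.2))) / b1 z.1.

Definition dens2 (z : X * (Y1 * Y2)) : R :=
  expR (- (lam2 * dist2 z.1 z.2.2)) / b2 z.1 z.2.1.

Definition dens (z : X * (Y1 * Y2)) : R := dens1 (z.1, z.2.1) * dens2 z.

Definition neglog_beta (x : X) : R := (1 + nu1) * ln (b1 x)^-1.

Lemma dens1_gt0 z : (0 < dens1 z)%R.
Proof. by rewrite divr_gt0 ?beta1_gt0//; exact: e1_gt0. Qed.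

Lemma dens2_gt0 z : (0 < dens2 z)%R.
Proof. by rewrite divr_gt0 ?beta2_gt0// expR_gt0. Qed.

Lemma dens_gt0 z : (0 < dens z)%R.
Proof. by rewrite mulr_gt0 ?dens1_gt0 ?dens2_gt0. Qed.

Lemma measurable_dens1 : measurable_fun [set: X * Y1] dens1.
Proof.
apply: measurable_funM => //.
exact: (measurableT_comp (measurable_funV_gt0 measurable_beta1 beta1_gt0)).
Qed.

Lemma measurable_dens2 : measurable_fun [set: X * (Y1 * Y2)] dens2.
Proof.
apply: measurable_funM.
  apply: measurableT_comp => //; apply: measurableT_comp => //.
  apply: measurable_funM => //.
  apply: (@measurableT_comp _ _ _ _ _ _ (fun p : X * Y2 => dist2 p.1 p.2)
    _ (fun p : X * (Y1 * Y2) => (p.1, p.2.2))) => //.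
  by apply: measurable_fun_pair => //; exact: measurableT_comp.
apply: (@measurable_funV_gt0 _ _ _ (fun z : X * (Y1 * Y2) => b2 z.1 z.2.1)).
  apply: (@measurableT_comp _ _ _ _ _ _ (fun p : X * Y1 => b2 p.1 p.2)
    _ (fun p : X * (Y1 * Y2) => (p.1, p.2.1))) => //.
    exact: measurable_beta2.
  by apply: measurable_fun_pair => //; exact: measurableT_comp.
by move=> z; exact: beta2_gt0.
Qed.

Lemma measurable_dens : measurable_fun [set: X * (Y1 * Y2)] dens.
Proof.
apply: measurable_funM; last exact: measurable_dens2.
apply: (measurableT_comp measurable_dens1).
by apply: measurable_fun_pair => //; exact: measurableT_comp.
Qed.

Lemma neglog_beta_ge0 x : (0 <= neglog_beta x)%R.
Proof.
apply: mulr_ge0; first exact: ltW.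
by rewrite lnV ?posrE ?beta1_gt0// oppr_ge0 ln_le0// beta1_le1.
Qed.

Lemma measurable_neglog_beta : measurable_fun [set: X] neglog_beta.
Proof.
apply: measurable_funM => //; apply: (measurableT_comp (@measurable_ln R)).
exact: (measurable_funV_gt0 measurable_beta1 beta1_gt0).
Qed.

(** The right side contains [(1 + nu1) ln dens1], so the exponent [1 / (1 + nu1)] produces exactly
    one [ln beta2], which [ln dens2] cancels. The identity is pointwise in [(y1, y2)], hence can be
    averaged under any law whose [X]-marginal is [PX]. *)
Lemma neglog_betaE x y1 y2 : (neglog_beta x = ln (dens (x, (y1, y2))) +
  nu1 * ln (dens1 (x, y1)) + (lam1 * dist1 x y1 + lam2 * dist2 x y2))%R.
Proof.
rewrite /dens lnM ?posrE ?dens1_gt0 ?dens2_gt0// /dens2 /dens1 /=.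
have b10 := beta1_gt0 x; have b20 := beta2_gt0 x y1.
rewrite !ln_div ?posrE ?expR_gt0//; last exact: e1_gt0.
rewrite lnM ?posrE ?expR_gt0 ?powR_gt0// !expRK ln_powR /neglog_beta.
rewrite lnV ?posrE//; move: (ln _) (ln _) => u v.
by field; rewrite gt_eqF.
Qed.

End beta_lemmas.

(** * Elementary logarithmic inequalities *)

Section log_inequalities.
Context {R : realType}.
Local Open Scope ring_scope.

Lemma ln_leB1 (x : R) : 0 < x -> ln x <= x - 1.
Proof.
by move=> x0; have := expR_ge1Dx (ln x); rewrite lnK ?posrE// lerBrDl.
Qed.

(** [ln (a / b)] is split as [ln (a c / b) + ln (1 / c)] and [ln u <= u - 1] is used twice. With [c]
    the new output density both bounds have mean 1, which accounts for the 2. *)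
Lemma ln_ratio_le (a b c : R) : 0 < a -> 0 < b -> 0 < c ->
  ln a - ln b + 2 <= a * c / b + c^-1.
Proof.
move=> a0 b0 c0.
have := ln_leB1 (divr_gt0 (mulr_gt0 a0 c0) b0).
rewrite ln_div ?posrE ?mulr_gt0// lnM ?posrE//.
have cV0 : 0 < c^-1 by rewrite invr_gt0.
by have := ln_leB1 cV0; rewrite lnV ?posrE//; lra.
Qed.

(** The term [1 * c / b] is kept on both sides so that the right side matches [slack] at the
    constant density 1. *)
Lemma klfun_div_le (b c : R) : 0 < b -> 0 < c ->
  ln (b / c) - 1 + c / b + 2 <= ln b + 1 * c / b + c^-1.
Proof.
move=> b0 c0; have cV0 : 0 < c^-1 by rewrite invr_gt0.
have := ln_leB1 cV0; rewrite lnV ?posrE// ln_div ?posrE// mul1r; lra.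
Qed.

End log_inequalities.

Lemma ge0_integral_lin4 d (T : measurableType d) (R : realType)
    (M : {measure set T -> \bar R}) (r1 r2 r3 r4 : T -> R) (c2 c3 c4 : R) :
  measurable_fun [set: T] r1 -> measurable_fun [set: T] r2 ->
  measurable_fun [set: T] r3 -> measurable_fun [set: T] r4 ->
  (forall z, (0 <= r1 z)%R) -> (forall z, (0 <= r2 z)%R) ->
  (forall z, (0 <= r3 z)%R) -> (forall z, (0 <= r4 z)%R) ->
  (0 <= c2)%R -> (0 <= c3)%R -> (0 <= c4)%R ->
  \int[M]_z (r1 z + c2 * r2 z + c3 * r3 z + c4 * r4 z)%:E =
  \int[M]_z (r1 z)%:E + c2%:E * \int[M]_z (r2 z)%:E +
  c3%:E * \int[M]_z (r3 z)%:E + c4%:E * \int[M]_z (r4 z)%:E.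
Proof.
move=> m1 m2 m3 m4 p1 p2 p3 p4 c20 c30 c40.
have ? z : 0 <= (r1 z)%:E by rewrite lee_fin.
have ? z : 0 <= (r2 z)%:E by rewrite lee_fin.
have ? z : 0 <= (r3 z)%:E by rewrite lee_fin.
have ? z : 0 <= (r4 z)%:E by rewrite lee_fin.
have ? z : 0 <= c2%:E * (r2 z)%:E by rewrite mule_ge0.
have ? z : 0 <= c3%:E * (r3 z)%:E by rewrite mule_ge0.
have ? z : 0 <= c4%:E * (r4 z)%:E by rewrite mule_ge0.
have ? : measurable_fun [set: T] (fun z => (r1 z)%:E) by exact/measurable_EFinP.
have ? : measurable_fun [set: T] (fun z => (r2 z)%:E) by exact/measurable_EFinP.
have ? : measurable_fun [set: T] (fun z => (r3 z)%:E) by exact/measurable_EFinP.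
have ? : measurable_fun [set: T] (fun z => (r4 z)%:E) by exact/measurable_EFinP.
have ? : measurable_fun [set: T] (fun z => c2%:E * (r2 z)%:E).
  exact: emeasurable_funM.
have ? : measurable_fun [set: T] (fun z => c3%:E * (r3 z)%:E).
  exact: emeasurable_funM.
have ? : measurable_fun [set: T] (fun z => c4%:E * (r4 z)%:E).
  exact: emeasurable_funM.
transitivity (\int[M]_z (((r1 z)%:E + c2%:E * (r2 z)%:E) + c3%:E * (r3 z)%:E +
    c4%:E * (r4 z)%:E)); first by apply: eq_integral.
rewrite ge0_integralD//; last 2 first.
- by move=> z _; rewrite !adde_ge0.
- by apply: emeasurable_funD => //; exact: emeasurable_funD.
rewrite ge0_integralD//; last 2 first.
- by move=> z _; rewrite adde_ge0.
- exact: emeasurable_funD.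
by rewrite ge0_integralD// !ge0_integralZl// lee_fin.
Qed.

(** * The iteration: monotonicity and comparison with the Lagrangian *)

Section blahut_iteration.
Context (dX dY1 dY2 : measure_display) (X : measurableType dX)
  (Y1 : measurableType dY1) (Y2 : measurableType dY2) (R : realType).
Variables (PX : probability X R) (dist1 : X -> Y1 -> R) (dist2 : X -> Y2 -> R).
Hypothesis hd1m : measurable_fun [set: X * Y1] (fun p => dist1 p.1 p.2).
Hypothesis hd2m : measurable_fun [set: X * Y2] (fun p => dist2 p.1 p.2).
Hypothesis hd1 : forall x y1, (0 <= dist1 x y1)%R.
Hypothesis hd2 : forall x y2, (0 <= dist2 x y2)%R.
Variables (nu1 lam1 lam2 : R).
Hypotheses (hnu1 : (0 < nu1)%R) (hlam1 : (0 < lam1)%R) (hlam2 : (0 < lam2)%R).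
Variables (P1 : nat -> probability Y1 R) (P21 : nat -> R.-pker Y1 ~> Y2).
Variables (Q1 : nat -> R.-pker X ~> Y1) (Q2 : nat -> R.-pker (X * Y1) ~> Y2).
Hypothesis hQ1 : forall k x A, measurable A ->
  Q1 k.+1 x A = \int[P1 k]_(y1 in A)
    ((beta2 dist2 lam2 (P21 k) x y1 `^ (1 + nu1)^-1 *
      expR (- (lam1 / (1 + nu1) * dist1 x y1))) /
     beta1 dist1 dist2 nu1 lam1 lam2 (P1 k) (P21 k) x)%R%:E.
Hypothesis hQ2 : forall k x y1 B, measurable B ->
  Q2 k.+1 (x, y1) B = \int[P21 k y1]_(y2 in B)
    (expR (- (lam2 * dist2 x y2)) / beta2 dist2 lam2 (P21 k) x y1)%R%:E.
Hypothesis hP1 : forall k A, measurable A ->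
  P1 k.+1 A = mixture PX (Q1 k.+1) A.
Hypothesis hP21 : forall k,
  is_cond_law PX (Q1 k.+1) (Q2 k.+1) (P1 k.+1) (P21 k.+1).

Let f1 k : X * Y1 -> R := dens1 dist1 dist2 nu1 lam1 lam2 (P1 k) (P21 k).
Let f2 k : X * (Y1 * Y2) -> R := dens2 dist2 lam2 (P21 k).
Let q k : X * (Y1 * Y2) -> R := dens dist1 dist2 nu1 lam1 lam2 (P1 k) (P21 k).
Let ell k : X -> R := neglog_beta dist1 dist2 nu1 lam1 lam2 (P1 k) (P21 k).
Let W k : probability (Y1 * Y2)%type R := semidirect (P1 k) (P21 k).
Let KK k : R.-pker X ~> (Y1 * Y2)%type := mkproduct (Q1 k.+1) (Q2 k.+1).
Let g k : Y1 -> R := mixdensr PX (f1 k).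
Let h k : Y1 * Y2 -> R := mixdensr PX (q k).

Let mf1 k : measurable_fun [set: X * Y1] (f1 k).
Proof. exact: measurable_dens1. Qed.
Let f1_gt0 k z : (0 < f1 k z)%R. Proof. exact: dens1_gt0. Qed.
Let mf2 k : measurable_fun [set: X * (Y1 * Y2)] (f2 k).
Proof. exact: measurable_dens2. Qed.
Let f2_gt0 k z : (0 < f2 k z)%R. Proof. exact: dens2_gt0. Qed.
Let mq k : measurable_fun [set: X * (Y1 * Y2)] (q k).
Proof. exact: measurable_dens. Qed.
Let q_gt0 k z : (0 < q k z)%R. Proof. exact: dens_gt0. Qed.
Let mell k : measurable_fun [set: X] (ell k).
Proof. exact: measurable_neglog_beta. Qed.
Let ell_ge0 k x : (0 <= ell k x)%R. Proof. exact: neglog_beta_ge0. Qed.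
Let mg k : measurable_fun [set: Y1] (g k).
Proof. exact: measurable_mixdensr. Qed.
Let g_gt0 k y : (0 < g k y)%R. Proof. exact: mixdensr_gt0. Qed.
Let mh k : measurable_fun [set: Y1 * Y2] (h k).
Proof. exact: measurable_mixdensr. Qed.
Let h_gt0 k y : (0 < h k y)%R. Proof. exact: mixdensr_gt0. Qed.

Let ellE k (z : X * (Y1 * Y2)) : (ell k z.1 = ln (q k z) +
  nu1 * ln (f1 k (z.1, z.2.1)) +
  (lam1 * dist1 z.1 z.2.1 + lam2 * dist2 z.1 z.2.2))%R.
Proof. by case: z => x [y1 y2]; exact: neglog_betaE. Qed.

Let K1E k x A : measurable A ->
  Q1 k.+1 x A = \int[P1 k]_(y in A) (f1 k (x, y))%:E.
Proof. exact: hQ1. Qed.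

Let integral_KK k x (phi : Y1 * Y2 -> \bar R) : (forall y, 0 <= phi y) ->
  measurable_fun [set: Y1 * Y2] phi ->
  \int[KK k x]_y phi y = \int[W k]_y ((q k (x, y))%:E * phi y).
Proof.
move=> phi0 mphi.
have mqx : measurable_fun [set: Y1 * Y2] (fun y => (q k (x, y))%:E).
  by apply/measurable_EFinP; exact: measurable_fun_pair2.
have mf2x : measurable_fun [set: Y1 * Y2] (fun y => (f2 k (x, y))%:E).
  by apply/measurable_EFinP; exact: measurable_fun_pair2.
have mfphi : measurable_fun [set: Y1 * Y2] (fun y => (f2 k (x, y))%:E * phi y).
  exact: emeasurable_funM.
have fphi0 y : 0 <= (f2 k (x, y))%:E * phi y.
  by rewrite mule_ge0// lee_fin ltW.
rewrite integral_mkproduct// integral_semidirect; last 2 first.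
- by move=> y; rewrite mule_ge0// lee_fin ltW.
- exact: emeasurable_funM.
transitivity (\int[Q1 k.+1 x]_y1 \int[P21 k y1]_y2
    ((f2 k (x, (y1, y2)))%:E * phi (y1, y2))).
  apply: eq_integral => y1 _.
  apply: (@integral_density _ _ _ _ _ (fun y2 => f2 k (x, (y1, y2)))).
  - have /measurable_EFinP := mf2x; exact: measurable_fun_pair2.
  - by move=> y2; exact: ltW.
  - by move=> B mB; exact: hQ2.
  - by [].
  - exact: (measurable_fun_pair2 _ mphi).
rewrite (@integral_density _ _ _ (P1 k) _ (fun y1 => f1 k (x, y1))).
- apply: eq_integral => y1 _.
  rewrite -ge0_integralZl//.
  + by apply: eq_integral => y2 _; rewrite muleA.
  + exact: (measurable_fun_pair2 _ mfphi).
  + by rewrite lee_fin ltW.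
- exact: measurable_fun_pair2.
- by move=> y1; exact: ltW.
- by move=> A mA; exact: K1E.
- by move=> y1; exact: integral_ge0.
- exact: (measurable_fun_integral_finite_kernel
    (fun y => (f2 k (x, y))%:E * phi y) (P21 k)).
Qed.

Let KKE k x A : measurable A ->
  KK k x A = \int[W k]_(y in A) (q k (x, y))%:E.
Proof.
move=> mA; rewrite -[in LHS](setIT A) -integral_indic//.
rewrite (@integral_KK k x (EFin \o \1_A)).
- rewrite [RHS]integral_mkcond; apply: eq_integral => y _.
  by rewrite patchE /= indicE; case: ifPn => _; rewrite ?mule1 ?mule0.
- by move=> y; rewrite lee_fin.
- exact/measurable_EFinP/measurable_indic.
Qed.

Let WE k A : measurable A -> W k.+1 A = mixture PX (KK k) A.
Proof. exact: (semidirect_cond_law (@hP21 k)). Qed.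

Let P1E k A : measurable A -> P1 k.+1 A = mixture PX (Q1 k.+1) A.
Proof. exact: hP1. Qed.

Let integral_f1 k x : \int[P1 k]_y (f1 k (x, y))%:E = 1.
Proof. by rewrite -K1E// prob_kernel. Qed.

Let integral_q k x : \int[W k]_y (q k (x, y))%:E = 1.
Proof. by rewrite -KKE// prob_kernel. Qed.

Let M k : probability (X * (Y1 * Y2))%type R := semidirect PX (KK k).

(* The terms left over when every logarithm of a likelihood ratio is replaced
   by its bound ln u <= u - 1; under [M k] each of the four has mean 1. *)
Let slack k (q' : X * (Y1 * Y2) -> R) (f' : X * Y1 -> R) z : R :=
  (q' z * h k z.2 / q k z + (h k z.2)^-1 +
   nu1 * (f' (z.1, z.2.1) * g k z.2.1 / f1 k (z.1, z.2.1) +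
          (g k z.2.1)^-1))%R.

Let m12 : measurable_fun [set: X * (Y1 * Y2)]
  (fun z : X * (Y1 * Y2) => (z.1, z.2.1)).
Proof. by apply: measurable_fun_pair => //; exact: measurableT_comp. Qed.

Let m21 : measurable_fun [set: X * (Y1 * Y2)]
  (fun z : X * (Y1 * Y2) => z.2.1).
Proof. exact: measurableT_comp. Qed.

Section slack.
Variables (k : nat) (q' : X * (Y1 * Y2) -> R) (f' : X * Y1 -> R).
Hypotheses (mq' : measurable_fun [set: X * (Y1 * Y2)] q')
  (mf' : measurable_fun [set: X * Y1] f').
Hypotheses (q'0 : forall z, (0 <= q' z)%R) (f'0 : forall z, (0 <= f' z)%R).
Hypothesis Iq' : forall x, \int[W k.+1]_y (q' (x, y))%:E = 1.
Hypothesis If' : forall x, \int[P1 k.+1]_y (f' (x, y))%:E = 1.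

Let r1 (z : X * (Y1 * Y2)) : R := (q' z * h k z.2 / q k z)%R.
Let r2 (z : X * (Y1 * Y2)) : R := ((h k z.2)^-1)%R.
Let r3 (z : X * Y1) : R := (f' z * g k z.2 / f1 k z)%R.
Let r4 (y : Y1) : R := ((g k y)^-1)%R.

Let mr1 : measurable_fun [set: X * (Y1 * Y2)] r1.
Proof.
apply: measurable_funM; last exact: (measurable_funV_gt0 (mq k) (@q_gt0 k)).
by apply: measurable_funM => //; exact: (measurableT_comp (mh k)).
Qed.
Let mr2 : measurable_fun [set: X * (Y1 * Y2)] r2.
Proof. exact: (measurableT_comp (measurable_funV_gt0 (mh k) (@h_gt0 k))). Qed.
Let mr3 : measurable_fun [set: X * Y1] r3.
Proof.
apply: measurable_funM; last exact: (measurable_funV_gt0 (mf1 k) (@f1_gt0 k)).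
by apply: measurable_funM => //; exact: (measurableT_comp (mg k)).
Qed.
Let mr4 : measurable_fun [set: Y1] r4.
Proof. exact: (measurable_funV_gt0 (mg k) (@g_gt0 k)). Qed.
Let r1_ge0 z : (0 <= r1 z)%R. Proof. by rewrite !mulr_ge0// ?invr_ge0 ltW. Qed.
Let r2_ge0 z : (0 <= r2 z)%R. Proof. by rewrite invr_ge0 ltW. Qed.
Let r3_ge0 z : (0 <= r3 z)%R. Proof. by rewrite !mulr_ge0// ?invr_ge0 ltW. Qed.
Let r4_ge0 z : (0 <= r4 z)%R. Proof. by rewrite invr_ge0 ltW. Qed.

Lemma slack_ge0 z : (0 <= slack k q' f' z)%R.
Proof.
rewrite -[slack _ _ _ _]/(r1 z + r2 z + nu1 * (r3 (z.1, z.2.1) + r4 z.2.1))%R.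
apply: addr_ge0; first exact: addr_ge0.
by apply: mulr_ge0; [exact: ltW|exact: addr_ge0].
Qed.

Lemma measurable_slack :
  measurable_fun [set: X * (Y1 * Y2)] (slack k q' f').
Proof.
apply: measurable_funD; first exact: measurable_funD.
apply: measurable_funM => //; apply: measurable_funD.
  exact: (measurableT_comp mr3 m12).
exact: (measurableT_comp mr4 m21).
Qed.

Lemma integral_slack : \int[M k]_z (slack k q' f' z)%:E = (2 + 2 * nu1)%:E.
Proof.
apply: (@integral_four _ _ _ (M k) r1 r2 (fun z => r3 (z.1, z.2.1))
  (fun z => r4 z.2.1)).
- exact: mr1.
- exact: mr2.
- exact: (measurableT_comp mr3 m12).
- exact: (measurableT_comp mr4 m21).
- exact: r1_ge0.
- exact: r2_ge0.
- by move=> z; exact: r3_ge0.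
- by move=> z; exact: r4_ge0.
- exact: ltW.
- rewrite integral_semidirect; last 2 first.
  + by move=> z; rewrite lee_fin.
  + exact/measurable_EFinP.
  exact: (@integral_step_ratio _ _ _ _ _ PX (W k) (W k.+1) (q k) (KK k)
    (mq k) (@q_gt0 k) (@KKE k) (@WE k) q').
- rewrite integral_semidirect; last 2 first.
  + by move=> z; rewrite lee_fin.
  + exact/measurable_EFinP.
  exact: (@integral_step_inv _ _ _ _ _ PX (W k) (W k.+1) (q k) (KK k)
    (mq k) (@q_gt0 k) (@KKE k) (@WE k)).
- rewrite (@integral_joint12 _ _ _ _ _ _ _ PX (Q1 k.+1) (Q2 k.+1)
    (fun z => (r3 z)%:E)); last 2 first.
  + by move=> z; rewrite lee_fin.
  + exact/measurable_EFinP.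
  exact: (@integral_step_ratio _ _ _ _ _ PX (P1 k) (P1 k.+1) (f1 k) (Q1 k.+1)
    (mf1 k) (@f1_gt0 k) (@K1E k) (@P1E k) f').
- rewrite (@integral_joint12 _ _ _ _ _ _ _ PX (Q1 k.+1) (Q2 k.+1)
    (fun z => (r4 z.2)%:E)); last 2 first.
  + by move=> z; rewrite lee_fin.
  + by apply/measurable_EFinP; exact: (measurableT_comp mr4).
  exact: (@integral_step_inv _ _ _ _ _ PX (P1 k) (P1 k.+1) (f1 k) (Q1 k.+1)
    (mf1 k) (@f1_gt0 k) (@K1E k) (@P1E k)).
Qed.

End slack.

Let integral_ell_M k j : \int[M k]_z (ell j z.1)%:E = \int[PX]_x (ell j x)%:E.
Proof.
apply: (@integral_joint1 _ _ _ _ _ _ _ PX (Q1 k.+1) (Q2 k.+1)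
  (fun x => (ell j x)%:E)); first by move=> x; rewrite lee_fin.
exact/measurable_EFinP.
Qed.

Let twonu_ge0 : (0 <= 2 + 2 * nu1)%R.
Proof. by rewrite addr_ge0// mulr_ge0// ltW. Qed.

(** The identity for [ell] is used at steps [k] and [k+1] at the same point under [M k]: the
    distortions cancel, and [ln_ratio_le] bounds the remaining log-ratios by terms of total mean
    [2 + 2 * nu1]. *)
Lemma iterate_nonincreasing k :
  \int[PX]_x (ell k.+1 x)%:E <= \int[PX]_x (ell k x)%:E.
Proof.
rewrite -!(integral_ell_M k).
apply: (@integral_le_normalized _ _ _ (M k) (fun z => ell k.+1 z.1)
  (fun z => ell k z.1) (slack k (q k.+1) (f1 k.+1)) (2 + 2 * nu1)) => //.
- exact: (measurableT_comp (mell k.+1)).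
- exact: (measurableT_comp (mell k)).
- exact: measurable_slack.
- by apply: slack_ge0 => z; exact: ltW.
- by apply: integral_slack => // z; exact: ltW.
- move=> z; rewrite (ellE k.+1) (ellE k) /slack.
  have := ln_ratio_le (q_gt0 k.+1 z) (q_gt0 k z) (h_gt0 k z.2).
  have := ln_ratio_le (f1_gt0 k.+1 (z.1, z.2.1)) (f1_gt0 k (z.1, z.2.1))
    (g_gt0 k z.2.1).
  rewrite -(ler_pM2l hnu1).
  move: (ln (q k.+1 z)) (ln (q k z)) (q k.+1 z * _ / _)%R (h k _)^-1%R.
  move: (ln (f1 k.+1 _)) (ln (f1 k _)) (f1 k.+1 _ * _ / _)%R (g k _)^-1%R.
  move: (dist1 _ _) (dist2 _ _) => *.
  by lra.
Qed.

(** The mutual informations refer to the new output laws, whereas [ell] involves densities with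
    respect to the old ones. The change can only lower the value, since the means of [ln h] and
    [ln g] under the new laws are nonnegative. *)
Lemma srL_iterate_le k :
  srL PX dist1 dist2 nu1 lam1 lam2 (Q1 k.+1) (Q2 k.+1) <=
  \int[PX]_x (ell k x)%:E.
Proof.
pose c2 (z : X * (Y1 * Y2)) : R :=
  (ln (q k z / h k z.2) - 1 + h k z.2 / q k z)%R.
pose c1 (z : X * Y1) : R :=
  (ln (f1 k z / g k z.2) - 1 + g k z.2 / f1 k z)%R.
have c2_ge0 z : (0 <= c2 z)%R by exact: klfun_div_ge0.
have c1_ge0 z : (0 <= c1 z)%R by exact: klfun_div_ge0.
have mc2 : measurable_fun [set: X * (Y1 * Y2)] c2.
  have mh2 : measurable_fun [set: X * (Y1 * Y2)] (fun z => h k z.2).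
    exact: (measurableT_comp (mh k)).
  apply: measurable_funD; last first.
    by apply: measurable_funM => //;
      exact: (measurable_funV_gt0 (mq k) (@q_gt0 k)).
  apply: measurable_funB => //; apply: (measurableT_comp (@measurable_ln R)).
  apply: measurable_funM => //.
  exact: (measurableT_comp (measurable_funV_gt0 (mh k) (@h_gt0 k))).
have mc1 : measurable_fun [set: X * Y1] c1.
  have mg2 : measurable_fun [set: X * Y1] (fun z => g k z.2).
    exact: (measurableT_comp (mg k)).
  apply: measurable_funD; last first.
    by apply: measurable_funM => //;
      exact: (measurable_funV_gt0 (mf1 k) (@f1_gt0 k)).
  apply: measurable_funB => //; apply: (measurableT_comp (@measurable_ln R)).
  apply: measurable_funM => //.
  exact: (measurableT_comp (measurable_funV_gt0 (mg k) (@g_gt0 k))).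
have md2 : measurable_fun [set: X * (Y1 * Y2)]
    (fun z : X * (Y1 * Y2) => dist2 z.1 z.2.2).
  apply: (@measurableT_comp _ _ _ _ _ _ (fun p : X * Y2 => dist2 p.1 p.2)
    _ (fun p : X * (Y1 * Y2) => (p.1, p.2.2))) => //.
  by apply: measurable_fun_pair => //; exact: measurableT_comp.
have md1 : measurable_fun [set: X * (Y1 * Y2)]
    (fun z : X * (Y1 * Y2) => dist1 z.1 z.2.1).
  exact: (measurableT_comp hd1m m12).
have mc12 : measurable_fun [set: X * (Y1 * Y2)]
    (fun z : X * (Y1 * Y2) => c1 (z.1, z.2.1)).
  exact: (measurableT_comp mc1 m12).
have -> : srL PX dist1 dist2 nu1 lam1 lam2 (Q1 k.+1) (Q2 k.+1) =
  \int[M k]_z (c2 z + nu1 * c1 (z.1, z.2.1) + lam1 * dist1 z.1 z.2.1 +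
    lam2 * dist2 z.1 z.2.2)%:E.
  rewrite ge0_integral_lin4//; try exact: ltW.
  rewrite /srL; congr (_ + _ * _ + _ * _ + _ * _).
  - rewrite (@mutual_info_step _ _ _ _ _ PX (W k) (W k.+1) (q k) (KK k)
      (mq k) (@q_gt0 k) (@KKE k) (@WE k)).
    rewrite integral_semidirect//.
    exact/measurable_EFinP.
  - rewrite (@mutual_info_step _ _ _ _ _ PX (P1 k) (P1 k.+1) (f1 k) (Q1 k.+1)
      (mf1 k) (@f1_gt0 k) (@K1E k) (@P1E k)).
    rewrite (@integral_joint12 _ _ _ _ _ _ _ PX (Q1 k.+1) (Q2 k.+1)
      (fun z => (c1 z)%:E))//.
    exact/measurable_EFinP.
  - rewrite (@integral_joint12 _ _ _ _ _ _ _ PX (Q1 k.+1) (Q2 k.+1)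
      (fun z => (dist1 z.1 z.2)%:E))//.
      by move=> z; rewrite lee_fin.
    exact/measurable_EFinP.
  - rewrite (@integral_joint123 _ _ _ _ _ _ _ PX (Q1 k.+1) (Q2 k.+1)
      (fun z => (dist2 z.1 z.2.2)%:E))//.
      by move=> z; rewrite lee_fin.
    exact/measurable_EFinP.
rewrite -(integral_ell_M k).
apply: (@integral_le_normalized _ _ _ (M k) _
  (fun z => ell k z.1) (slack k (cst 1%R) (cst 1%R)) (2 + 2 * nu1)) => //.
- by do 3 (apply: measurable_funD; last exact: measurable_funM);
    exact: mc2.
- exact: (measurableT_comp (mell k)).
- exact: measurable_slack.
- by move=> z; do !apply: addr_ge0 => //; apply: mulr_ge0 => //; exact: ltW.
- exact: slack_ge0.
- apply: integral_slack => // x.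
  + exact: probability_integral_eq1.
  + exact: probability_integral_eq1.
- move=> z; rewrite (ellE k) /slack /c2 /c1 /=.
  have := klfun_div_le (q_gt0 k z) (h_gt0 k z.2).
  have := klfun_div_le (f1_gt0 k (z.1, z.2.1)) (g_gt0 k z.2.1).
  rewrite -(ler_pM2l hnu1).
  move: (ln (q k z)) (h k _)^-1%R (h k _ / _)%R (1 * h k _ / _)%R
    (ln (q k z / _)).
  move: (ln (f1 k _)) (g k _)^-1%R (g k _ / _)%R (1 * g k _ / _)%R
    (ln (f1 k _ / _)).
  move: (dist1 _ _) (dist2 _ _) => *.
  by lra.
Qed.

Let integral_W k (phi : Y1 * Y2 -> \bar R) : (forall y, 0 <= phi y) ->
  measurable_fun [set: Y1 * Y2] phi ->
  \int[W k.+1]_y phi y = \int[W k]_y ((h k y)%:E * phi y).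
Proof. exact: (integral_step (mq k) (@q_gt0 k) (@KKE k) (@WE k)). Qed.

Let integral_P1 k (phi : Y1 -> \bar R) : (forall y, 0 <= phi y) ->
  measurable_fun [set: Y1] phi ->
  \int[P1 k.+1]_y phi y = \int[P1 k]_y ((g k y)%:E * phi y).
Proof. exact: (integral_step (mf1 k) (@f1_gt0 k) (@K1E k) (@P1E k)). Qed.

(** * Comparison with the optimal kernels *)

Variables (K1s : R.-pker X ~> Y1) (K2s : R.-pker (X * Y1) ~> Y2).
Variable P21s : R.-pker Y1 ~> Y2.
Hypothesis hP21s : is_cond_law PX K1s K2s (mixture PX K1s) P21s.
Hypothesis hinit1 : rel_entropy (mixture PX K1s) (P1 0%N) < +oo.
Hypothesis hinit2 :
  cond_rel_entropy P21s (P21 0%N) (mixture PX K1s) < +oo.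

Let Ks : R.-pker X ~> (Y1 * Y2)%type := mkproduct K1s K2s.
Let P1s : probability Y1 R := mixture_fun PX K1s.
Let Ws : probability (Y1 * Y2)%type R := mixture_fun PX Ks.
Let Ms : probability (X * (Y1 * Y2))%type R := semidirect PX Ks.

Let WsE C : measurable C -> semidirect P1s P21s C = Ws C.
Proof. exact: (@semidirect_cond_law _ _ _ _ _ _ _ PX K1s K2s P1s P21s hP21s). Qed.

Let semidirectE (P : probability Y1 R) (k : R.-pker Y1 ~> Y2) C :
  semidirect P k C = \int[P]_u k u (xsection C u).
Proof.
by apply: eq_integral => u _; rewrite xsectionE.
Qed.

Let P1s_null N : measurable N -> P1 0%N N = 0 -> P1s N = 0.
Proof.
move=> mN P0; have [p pd] := rel_entropy_lty hinit1.
have mI : measurable_fun [set: Y1] (fun y => (\1_N y)%:E : \bar R).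
  exact/measurable_EFinP/measurable_indic.
rewrite -(setIT N) -integral_indic//.
apply: (integral_density_null pd) => //.
by rewrite integral_indic// setIT.
Qed.

(** Two dominations in succession: [hinit1] makes the sections of [N] null under the initial kernel
    for almost every [y1] of the optimal marginal, and [hinit2] then changes the kernel. *)
Let Ws_null N : measurable N -> W 0%N N = 0 -> Ws N = 0.
Proof.
move=> mN W0; have [p pd] := rel_entropy_lty hinit1.
have m0 : measurable_fun [set: Y1] (fun u => P21 0%N u (xsection N u)).
  by apply: measurable_fun_xsection_finite_kernel; rewrite inE.
rewrite -WsE// semidirectE; apply: (cond_rel_entropy_dominates _ mN hinit2) => //.
- by move=> u; exact: prob_kernel.
- apply: (integral_density_null pd) => //.
  by rewrite -semidirectE.
Qed.

Let Ws_mixdens k : Ws [set y | mixdens PX (q k) y = +oo] = 0.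
Proof.
have mN := measurable_mixdens_oo PX (mq k) (@q_gt0 k).
apply: Ws_null => //; apply: (chain_null mh h_gt0 integral_W (n := k)) => //.
exact: (mixdens_oo_null (mq k) (@q_gt0 k) (@KKE k) (@WE k)).
Qed.

Let P1s_mixdens k : P1s [set y | mixdens PX (f1 k) y = +oo] = 0.
Proof.
have mN := measurable_mixdens_oo PX (mf1 k) (@f1_gt0 k).
apply: P1s_null => //; apply: (chain_null mg g_gt0 integral_P1 (n := k)) => //.
exact: (mixdens_oo_null (mf1 k) (@f1_gt0 k) (@K1E k) (@P1E k)).
Qed.

Let I2 := mutual_info PX Ks.
Let I1 := mutual_info PX K1s.
Let D2 := cond_rel_entropy P21s (P21 0%N) (mixture PX K1s).
Let D1 := rel_entropy (mixture PX K1s) (P1 0%N).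

Let I2_ge0 : 0 <= I2.
Proof. by apply: cond_rel_entropy_ge0 => _; exact: (probability_setT Ws). Qed.
Let I1_ge0 : 0 <= I1.
Proof. by apply: cond_rel_entropy_ge0 => _; exact: (probability_setT P1s). Qed.
Let D2_ge0 : 0 <= D2.
Proof.
by apply: (@cond_rel_entropy_ge0 _ _ _ _ _ P1s) => u; exact: prob_kernel.
Qed.
Let D1_ge0 : 0 <= D1.
Proof.
by apply: rel_entropy_ge0; [exact: (probability_setT P1s)
  |exact: probability_setT].
Qed.

Let add_lty (x y : \bar R) : 0 <= x -> 0 <= y -> x + y < +oo ->
  x < +oo /\ y < +oo.
Proof.
by case: x => [r| |]//; case: y => [s| |]// _ _ _; rewrite !ltry.
Qed.

Section bound.
Variable n : nat.

Let a2 (i : 'I_n.+1) (z : X * (Y1 * Y2)) : R := (ln (q i z) - ln (h i z.2))%R.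
Let a1 (i : 'I_n.+1) (z : X * Y1) : R := (ln (f1 i z) - ln (g i z.2))%R.
(** Averages rather than sums, so that the exponential moments stay at most 1. *)
Let t1 z : R := (n.+1%:R^-1 * \sum_i a2 i z)%R.
Let t2 z : R := (n.+1%:R^-1 * \sum_i a1 i z)%R.
Let S := log_chain h n.+1.
Let S1 := log_chain g n.+1.
(** A joint log-density minus a marginal one: the log-density of the conditional law of [Y2] given
    [Y1] at step [n+1] relative to the initial one. *)
Let t3 (y : Y1 * Y2) : R := (S y - S1 y.1)%R.

Let ma2 i : measurable_fun [set: X * (Y1 * Y2)] (a2 i).
Proof.
apply: measurable_funB; apply: (measurableT_comp (@measurable_ln R)) => //.
exact: (measurableT_comp (mh i)).
Qed.
Let ma1 i : measurable_fun [set: X * Y1] (a1 i).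
Proof.
apply: measurable_funB; apply: (measurableT_comp (@measurable_ln R)) => //.
exact: (measurableT_comp (mg i)).
Qed.
Let mt1 : measurable_fun [set: X * (Y1 * Y2)] t1.
Proof. by apply: measurable_funM => //; exact: measurable_sum. Qed.
Let mt2 : measurable_fun [set: X * Y1] t2.
Proof. by apply: measurable_funM => //; exact: measurable_sum. Qed.
Let mS : measurable_fun [set: Y1 * Y2] S.
Proof. exact: measurable_log_chain. Qed.
Let mS1 : measurable_fun [set: Y1] S1.
Proof. exact: measurable_log_chain. Qed.
Let mt3 : measurable_fun [set: Y1 * Y2] t3.
Proof.
exact: (measurable_funB mS (measurableT_comp mS1 measurable_fst)).
Qed.

Let E1 : \int[PX]_x \int[Ws]_y (expR (t1 (x, y)))%:E <= 1.
Proof.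
apply: (integral_expR_mean_le1 ma2) => i.
rewrite -[RHS](integral_div_mixdensr (mq i) (@q_gt0 i) (Ws_mixdens i)).
apply: eq_integral => x _; apply: eq_integral => y _.
by rewrite /a2 expRB !lnK ?posrE.
Qed.

Let E2 : \int[PX]_x \int[P1s]_y (expR (t2 (x, y)))%:E <= 1.
Proof.
apply: (integral_expR_mean_le1 ma1) => i.
rewrite -[RHS](integral_div_mixdensr (mf1 i) (@f1_gt0 i) (P1s_mixdens i)).
apply: eq_integral => x _; apply: eq_integral => y _.
by rewrite /a1 expRB !lnK ?posrE.
Qed.

Let E4 : \int[P1 0%N]_y (expR (S1 y))%:E = 1.
Proof.
transitivity (\int[P1 n.+1]_y (cst 1 y)); last exact: probability_integral_eq1.
rewrite (integral_chain mg g_gt0 integral_P1 n.+1)//.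
by apply: eq_integral => y _; rewrite mule1.
Qed.

(** With [p] the density of the optimal marginal, [expR S] leads from the initial joint law to that
    of step [n+1]. There [p * expR (- S1)] depends on [y1] alone, and returning to the initial
    marginal multiplies it by [expR S1], leaving the integral of [p]. *)
Let E3 : \int[P1s]_y1 \int[P21 0%N y1]_y2 (expR (t3 (y1, y2)))%:E <= 1.
Proof.
have [p [mp p0 pE]] := rel_entropy_lty hinit1.
have met3 : measurable_fun [set: Y1 * Y2] (fun y => (expR (t3 y))%:E).
  by apply/measurable_EFinP; exact: measurableT_comp.
have et3 y : 0 <= (expR (t3 y))%:E by rewrite lee_fin expR_ge0.
rewrite (integral_density mp p0 pE); last 2 first.
- by move=> y; exact: integral_ge0.
- exact: (measurable_fun_integral_finite_kernel (fun y => (expR (t3 y))%:E)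
    (P21 0%N)).
pose G (y : Y1) : R := (p y * expR (- S1 y))%R.
have G0 y : 0 <= (G y)%:E by rewrite lee_fin mulr_ge0// expR_ge0.
have mG : measurable_fun [set: Y1] (fun y => (G y)%:E).
  apply/measurable_EFinP; apply: measurable_funM => //.
  by apply: measurableT_comp => //; exact: measurableT_comp.
have mG1 : measurable_fun [set: Y1 * Y2] (fun y => (G y.1)%:E).
  exact: (measurableT_comp mG).
have meS : measurable_fun [set: Y1 * Y2] (fun y => (expR (S y))%:E).
  by apply/measurable_EFinP; exact: measurableT_comp.
suff -> : \int[P1 0%N]_y1 ((p y1)%:E *
    \int[P21 0%N y1]_y2 (expR (t3 (y1, y2)))%:E) = 1 by [].
transitivity (\int[W 0%N]_y ((expR (S y))%:E * (G y.1)%:E)).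
  rewrite integral_semidirect; last 2 first.
  - by move=> y; rewrite mule_ge0// lee_fin expR_ge0.
  - exact: emeasurable_funM.
  apply: eq_integral => y1 _; rewrite -ge0_integralZl//.
  + apply: eq_integral => y2 _; rewrite -!EFinM /t3 /G expRB expRN/=; congr EFin.
    by ring.
  + exact: (measurable_fun_pair2 _ met3).
  + by rewrite lee_fin.
rewrite -(integral_chain mh h_gt0 integral_W n.+1)//.
rewrite integral_semidirect//.
transitivity (\int[P1 n.+1]_y (G y)%:E).
  apply: eq_integral => y _ /=; rewrite integral_cst//.
  by rewrite -[RHS]mule1; congr (_ * _); exact: prob_kernel.
rewrite (integral_chain mg g_gt0 integral_P1 n.+1)//.
transitivity (\int[P1 0%N]_y (p y)%:E).
  apply: eq_integral => y _; rewrite -EFinM; congr EFin.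
  by rewrite /G mulrCA -expRD subrr expR0 mulr1.
by rewrite -pE//; exact: (probability_setT P1s).
Qed.

Let pos0 (r : R) : 0 <= (Num.max r 0%R)%:E.
Proof. by rewrite lee_fin le_max lexx orbT. Qed.

Let mpos d (T : measurableType d) (t : T -> R) : measurable_fun [set: T] t ->
  measurable_fun [set: T] (fun z => (Num.max (t z) 0%R)%:E).
Proof. by move=> mt; apply/measurable_EFinP; exact: measurable_maxr. Qed.

Let mneg d (T : measurableType d) (t : T -> R) : measurable_fun [set: T] t ->
  measurable_fun [set: T] (fun z => (Num.max (- t z) 0%R)%:E).
Proof. by move=> mt; apply: mpos; exact: measurableT_comp. Qed.

Let T1 (z : X * (Y1 * Y2)) : R := t1 z.
Let T2 (z : X * (Y1 * Y2)) : R := t2 (z.1, z.2.1).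
Let T3 (z : X * (Y1 * Y2)) : R := t3 z.2.
Let T4 (z : X * (Y1 * Y2)) : R := S1 z.2.1.

Let integral_Ms3 (phi : Y1 * Y2 -> \bar R) : (forall y, 0 <= phi y) ->
  measurable_fun [set: Y1 * Y2] phi ->
  \int[Ms]_z phi z.2 = \int[P1s]_y1 \int[P21s y1]_y2 phi (y1, y2).
Proof.
move=> phi0 mphi; rewrite -integral_semidirect// integral_joint23//.
by apply: eq_measure_integral => C mC _; exact/esym/WsE.
Qed.

(** In this and the next three facts, the first inequality is the sharp one; the second makes the
    positive part integrable once the divergence is finite, as [integral_le_sum_bounds] requires. *)
Let gibbs1 : \int[Ms]_z (Num.max (T1 z) 0%R)%:E <=
    I2 + \int[Ms]_z (Num.max (- T1 z) 0%R)%:E /\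
  \int[Ms]_z (Num.max (T1 z) 0%R)%:E <= I2 + 1.
Proof.
have mE (e : X * (Y1 * Y2) -> R) : measurable_fun [set: X * (Y1 * Y2)] e ->
    (forall z, (0 <= e z)%R) ->
    measurable_fun [set: X] (fun x => \int[Ws]_y (e (x, y))%:E).
  move=> me e0; apply: (@measurable_fun_fubini_tonelli_F _ _ _ _ _ Ws
    (fun z => (e z)%:E)); first exact/measurable_EFinP.
  by move=> z; rewrite lee_fin.
have W1 (x : X) : mixture PX Ks setT = 1 by exact: (probability_setT Ws).
have met1 : measurable_fun [set: X * (Y1 * Y2)] (expR \o t1).
  exact: measurableT_comp.
rewrite !integral_semidirect; [|by []|exact: mneg|by []|exact: mpos].
split.
  exact: (@cond_gibbs_le1 _ _ _ _ _ PX Ks (fun=> mixture PX Ks) W1 _ mt1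
    (mE _ met1 (fun z => expR_ge0 _)) E1).
apply: (le_trans (@cond_gibbs_pos _ _ _ _ _ PX Ks (fun=> mixture PX Ks)
  W1 _ mt1 mE)).
exact: leeD2l.
Qed.

Let gibbs2 : \int[Ms]_z (Num.max (T2 z) 0%R)%:E <=
    I1 + \int[Ms]_z (Num.max (- T2 z) 0%R)%:E /\
  \int[Ms]_z (Num.max (T2 z) 0%R)%:E <= I1 + 1.
Proof.
have mE (e : X * Y1 -> R) : measurable_fun [set: X * Y1] e ->
    (forall z, (0 <= e z)%R) ->
    measurable_fun [set: X] (fun x => \int[P1s]_y (e (x, y))%:E).
  move=> me e0; apply: (@measurable_fun_fubini_tonelli_F _ _ _ _ _ P1s
    (fun z => (e z)%:E)); first exact/measurable_EFinP.
  by move=> z; rewrite lee_fin.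
have W1 (x : X) : mixture PX K1s setT = 1 by exact: (probability_setT P1s).
have met2 : measurable_fun [set: X * Y1] (expR \o t2).
  exact: measurableT_comp.
rewrite (@integral_joint12 _ _ _ _ _ _ _ PX K1s K2s
  (fun z => (Num.max (t2 z) 0%R)%:E)); [|by []|exact: mpos].
rewrite (@integral_joint12 _ _ _ _ _ _ _ PX K1s K2s
  (fun z => (Num.max (- t2 z) 0%R)%:E)); [|by []|exact: mneg].
split.
  exact: (@cond_gibbs_le1 _ _ _ _ _ PX K1s (fun=> mixture PX K1s) W1 _ mt2
    (mE _ met2 (fun z => expR_ge0 _)) E2).
apply: (le_trans (@cond_gibbs_pos _ _ _ _ _ PX K1s (fun=> mixture PX K1s)
  W1 _ mt2 mE)).
exact: leeD2l.
Qed.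

Let gibbs3 : \int[Ms]_z (Num.max (T3 z) 0%R)%:E <=
    D2 + \int[Ms]_z (Num.max (- T3 z) 0%R)%:E /\
  \int[Ms]_z (Num.max (T3 z) 0%R)%:E <= D2 + 1.
Proof.
have mE (e : Y1 * Y2 -> R) : measurable_fun [set: Y1 * Y2] e ->
    (forall z, (0 <= e z)%R) ->
    measurable_fun [set: Y1] (fun x => \int[P21 0%N x]_y (e (x, y))%:E).
  move=> me e0; apply: (measurable_fun_integral_finite_kernel
    (fun z => (e z)%:E) (P21 0%N)); last exact/measurable_EFinP.
  by move=> z; rewrite lee_fin.
have W1 (y : Y1) : P21 0%N y setT = 1 by exact: prob_kernel.
have met3 : measurable_fun [set: Y1 * Y2] (expR \o t3).
  exact: measurableT_comp.
rewrite (@integral_Ms3 (fun z => (Num.max (t3 z) 0%R)%:E));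
  [|by []|exact: mpos].
rewrite (@integral_Ms3 (fun z => (Num.max (- t3 z) 0%R)%:E));
  [|by []|exact: mneg].
split.
  exact: (@cond_gibbs_le1 _ _ _ _ _ P1s P21s _ W1 _ mt3
    (mE _ met3 (fun z => expR_ge0 _)) E3).
apply: (le_trans (@cond_gibbs_pos _ _ _ _ _ P1s P21s _ W1 _ mt3 mE)).
exact: leeD2l.
Qed.

Let gibbs4 : \int[Ms]_z (Num.max (T4 z) 0%R)%:E <=
    D1 + \int[Ms]_z (Num.max (- T4 z) 0%R)%:E /\
  \int[Ms]_z (Num.max (T4 z) 0%R)%:E <= D1 + 1.
Proof.
rewrite (@integral_joint2 _ _ _ _ _ _ _ PX K1s K2s
  (fun z => (Num.max (S1 z) 0%R)%:E)); [|by []|exact: mpos].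
rewrite (@integral_joint2 _ _ _ _ _ _ _ PX K1s K2s
  (fun z => (Num.max (- S1 z) 0%R)%:E)); [|by []|exact: mneg].
have P1s1 : mixture PX K1s setT = 1 by exact: (probability_setT P1s).
have P01 : P1 0%N setT = 1 by exact: probability_setT.
split.
  rewrite -(@leeD2rE _ 1)//.
  apply: (le_trans (gibbs P1s1 P01 mS1)); rewrite E4 -/D1.
  move: D1 => D; rewrite -(addeA D); apply: (leeD2l D).
  by rewrite [leRHS]addeC.
by apply: (le_trans (gibbs_pos P1s1 P01 mS1)); rewrite E4.
Qed.

(** Summing the identity for [ell] at a common point gives [n+1] copies of the averages [t1],
    [nu1 * t2] and the distortion terms, plus [t3 + (1 + nu1) * S1]. Gibbs bounds these log terms by
    [I2], [I1], [D2] and [D1] respectively. *)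
Lemma sum_iterates_le :
  srL PX dist1 dist2 nu1 lam1 lam2 K1s K2s < +oo ->
  \sum_(k < n.+1) \int[PX]_x (ell k x)%:E <=
  n.+1%:R%:E * srL PX dist1 dist2 nu1 lam1 lam2 K1s K2s +
  ((1 + nu1)%:E * D1 + D2).
Proof.
set d1 := \int[PX]_x \int[K1s x]_y1 (dist1 x y1)%:E.
set d2 := \int[PX]_x \int[K1s x]_y1 \int[K2s (x, y1)]_y2 (dist2 x y2)%:E.
have d1_ge0 : 0 <= d1.
  by apply: integral_ge0 => x _; apply: integral_ge0 => y _; rewrite lee_fin.
have d2_ge0 : 0 <= d2.
  by apply: integral_ge0 => x _; apply: integral_ge0 => y _;
    apply: integral_ge0 => z _; rewrite lee_fin.
have md2 : measurable_fun [set: X * (Y1 * Y2)]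
    (fun z : X * (Y1 * Y2) => dist2 z.1 z.2.2).
  apply: (@measurableT_comp _ _ _ _ _ _ (fun p : X * Y2 => dist2 p.1 p.2)
    _ (fun p : X * (Y1 * Y2) => (p.1, p.2.2))) => //.
  by apply: measurable_fun_pair => //; exact: measurableT_comp.
have md1 : measurable_fun [set: X * (Y1 * Y2)]
    (fun z : X * (Y1 * Y2) => dist1 z.1 z.2.1).
  exact: (measurableT_comp hd1m m12).
have d1E : \int[Ms]_z (dist1 z.1 z.2.1)%:E = d1.
  rewrite (@integral_joint12 _ _ _ _ _ _ _ PX K1s K2s
    (fun z => (dist1 z.1 z.2)%:E))//; last exact/measurable_EFinP.
  by move=> z; rewrite lee_fin.
have d2E : \int[Ms]_z (dist2 z.1 z.2.2)%:E = d2.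
  rewrite (@integral_joint123 _ _ _ _ _ _ _ PX K1s K2s
    (fun z => (dist2 z.1 z.2.2)%:E))//; last exact/measurable_EFinP.
  by move=> z; rewrite lee_fin.
rewrite /srL -/I2 -/I1 -/d1 -/d2.
have nI1 : 0 <= nu1%:E * I1 by rewrite mule_ge0// lee_fin ltW.
have ld1 : 0 <= lam1%:E * d1 by rewrite mule_ge0// lee_fin ltW.
have ld2 : 0 <= lam2%:E * d2 by rewrite mule_ge0// lee_fin ltW.
move=> Loo.
(* The four summands of the Lagrangian are nonnegative with positive multipliers, so each is
   finite. *)
have [d2oo d1oo I1oo I2oo] : [/\ d2 < +oo, d1 < +oo, I1 < +oo & I2 < +oo].
  have fin_factor (c : R) (e : \bar R) : (0 < c)%R -> 0 <= e ->
      c%:E * e < +oo -> e < +oo.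
    by move=> c0; case: e => [r| |]// _; rewrite ?ltry// gt0_muley ?lte_fin.
  have [Loo1 /(fin_factor _ _ hlam2 d2_ge0) ?] := add_lty (adde_ge0 (adde_ge0
    I2_ge0 nI1) ld1) ld2 Loo.
  have [Loo2 /(fin_factor _ _ hlam1 d1_ge0) ?] :=
    add_lty (adde_ge0 I2_ge0 nI1) ld1 Loo1.
  by have [? /(fin_factor _ _ hnu1 I1_ge0) ?] := add_lty I2_ge0 nI1 Loo2.
have N0 : (0 <= n.+1%:R :> R)%R by [].
have [n0 l10 l20] : [/\ 0 <= nu1, 0 <= lam1 & 0 <= lam2]%R.
  by split; exact: ltW.
(* The zeros fill the first two slots of [ge0_integral_lin4]. *)
have DE : \int[Ms]_z (0 + 0 * 0 + n.+1%:R * lam1 * dist1 z.1 z.2.1 +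
    n.+1%:R * lam2 * dist2 z.1 z.2.2)%:E =
    (n.+1%:R * lam1)%:E * d1 + (n.+1%:R * lam2)%:E * d2.
  rewrite (@ge0_integral_lin4 _ _ _ Ms (cst 0%R) (cst 0%R)
    (fun z => dist1 z.1 z.2.1) (fun z => dist2 z.1 z.2.2))//.
  - by rewrite d1E d2E integral0 mule0 !add0e.
  - exact: mulr_ge0.
  - exact: mulr_ge0.
have fin (e : \bar R) : 0 <= e -> e < +oo -> exists2 r : R, e = r%:E & (0 <= r)%R.
  by case: e => [r| |]//; exists r.
(* The factor [n.+1] undoes the averaging in [t1] and [t2]; the last two weights come from
   [S + nu1 * S1 = (S - S1) + (1 + nu1) * S1]. *)
pose w := nth 0%R [:: n.+1%:R; (n.+1%:R * nu1)%R; 1%R; (1 + nu1)%R] : nat -> R.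
pose t := nth (cst 0%R) [:: T1; T2; T3; T4].
pose b := nth 0 [:: I2; I1; D2; D1].
rewrite (_ : \sum_(k < n.+1) \int[PX]_x (ell k x)%:E =
    \int[Ms]_z (\sum_(k < n.+1) ell k z.1)%:E); last first.
  under [RHS]eq_integral do rewrite -sumEFin.
  rewrite ge0_integral_sum//.
  - apply: eq_bigr => k _; apply/esym.
    apply: (@integral_joint1 _ _ _ _ _ _ _ PX K1s K2s (fun x => (ell k x)%:E)).
      by move=> x; rewrite lee_fin.
    exact/measurable_EFinP.
  - move=> k; apply: (@measurableT_comp _ _ _ _ _ _ (fun x => (ell k x)%:E)) => //.
    exact/measurable_EFinP.
  - by move=> k z _; rewrite lee_fin.
have {}bound : \int[Ms]_z (\sum_(k < n.+1) ell k z.1)%:E <=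
    \sum_(i < 4) (w i)%:E * b i +
    \int[Ms]_z (0 + 0 * 0 + n.+1%:R * lam1 * dist1 z.1 z.2.1 +
      n.+1%:R * lam2 * dist2 z.1 z.2.2)%:E.
  apply: (@integral_le_sum_bounds _ _ _ Ms 4 (fun i => w i) (fun i => t i)
    (fun z => \sum_(k < n.+1) ell k z.1)%R _ (fun i => b i)).
  - case=> -[|[|[|[|//]]]] _ /=.
    + exact: mt1.
    + exact: (measurableT_comp mt2 m12).
    + exact: (measurableT_comp mt3).
    + exact: (measurableT_comp mS1 m21).
  - by apply: measurable_sum => k; exact: (measurableT_comp (mell k)).
  - by apply: measurable_funD; [apply: measurable_funD => //|];
      exact: measurable_funM.
  - by case=> -[|[|[|[|//]]]] _ /=; rewrite ?mulr_ge0 ?addr_ge0.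
  - by move=> z; apply: sumr_ge0 => k _.
  - by move=> z; rewrite mul0r !add0r addr_ge0// !mulr_ge0.
  - by case=> -[|[|[|[|//]]]] _ /=.
  - move=> z.
    have sum4 (F : nat -> R) :
        (\sum_(i < 4) F i = F 0%N + F 1%N + F 2%N + F 3%N)%R.
      by rewrite !big_ord_recl big_ord0 addr0 !addrA.
    rewrite (sum4 (fun i => w i * t i z)%R) /w /t /=.
    have -> : (\sum_(k < n.+1) ell k z.1 = \sum_i a2 i z +
        nu1 * \sum_i a1 i (z.1, z.2.1) + (S z.2 + nu1 * S1 z.2.1) +
        n.+1%:R * (lam1 * dist1 z.1 z.2.1 + lam2 * dist2 z.1 z.2.2))%R.
      rewrite /S /S1 /log_chain !mulr_sumr -!big_split/=.
      rewrite mulr_natl -[in X in (_ + X)%R](card_ord n.+1) -sumr_const.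
      rewrite -big_split/=; apply: eq_bigr => i _; rewrite (ellE i) /a2 /a1 /=.
      by ring.
    rewrite /T1 /T2 /T3 /T4 /t1 /t2 /t3.
    have N1 : (n.+1%:R != 0 :> R)%R by rewrite pnatr_eq0.
    move: (\sum_i a2 i z)%R (\sum_i a1 i _)%R (S _) (S1 _) => s2 s1 s s'.
    move: (dist1 _ _) (dist2 _ _) (n.+1%:R) N1 => e1 e2 N N1.
    by field.
  - case=> -[|[|[|[|//]]]] _ /=.
    + by apply: (le_lt_trans gibbs1.2); rewrite lte_add_pinfty ?ltry.
    + by apply: (le_lt_trans gibbs2.2); rewrite lte_add_pinfty ?ltry.
    + by apply: (le_lt_trans gibbs3.2); rewrite lte_add_pinfty ?ltry.
    + by apply: (le_lt_trans gibbs4.2); rewrite lte_add_pinfty ?ltry.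
  - case=> -[|[|[|[|//]]]] _ /=.
    + exact: gibbs1.1.
    + exact: gibbs2.1.
    + exact: gibbs3.1.
    + exact: gibbs4.1.
  - by rewrite DE lte_add_pinfty// lte_mul_pinfty// lee_fin mulr_ge0.
apply: (le_trans bound); rewrite DE !big_ord_recl big_ord0 /w /b /=.
have [i2 -> _] := fin _ I2_ge0 I2oo; have [i1 -> _] := fin _ I1_ge0 I1oo.
have [e2 -> _] := fin _ D2_ge0 hinit2; have [e1 -> _] := fin _ D1_ge0 hinit1.
have [c2 -> _] := fin _ d2_ge0 d2oo; have [c1 -> _] := fin _ d1_ge0 d1oo.
rewrite -[leLHS]/((n.+1%:R * i2 + (n.+1%:R * nu1 * i1 + (1 * e2 +
  ((1 + nu1) * e1 + 0))) + (n.+1%:R * lam1 * c1 + n.+1%:R * lam2 * c2))%R%:E).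
rewrite -[leRHS]/((n.+1%:R * (i2 + nu1 * i1 + lam1 * c1 + lam2 * c2) +
  ((1 + nu1) * e1 + e2))%R%:E).
by rewrite lee_fin le_eqVlt; apply/orP; left; apply/eqP; ring.
Qed.

End bound.
End blahut_iteration.

(** * Conclusion: limit and rate *)

Lemma srL_ge0 dX d1 d2 (X : measurableType dX) (Y1 : measurableType d1)
    (Y2 : measurableType d2) (R : realType) (PX : probability X R)
    (dist1 : X -> Y1 -> R) (dist2 : X -> Y2 -> R) (nu1 lam1 lam2 : R)
    (K1 : R.-pker X ~> Y1) (K2 : R.-pker (X * Y1) ~> Y2) :
  (forall x y1, (0 <= dist1 x y1)%R) -> (forall x y2, (0 <= dist2 x y2)%R) ->
  (0 <= nu1)%R -> (0 <= lam1)%R -> (0 <= lam2)%R ->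
  0 <= srL PX dist1 dist2 nu1 lam1 lam2 K1 K2.
Proof.
move=> hd1 hd2 n0 l10 l20; rewrite /srL.
have I2_ge0 : 0 <= mutual_info PX (mkproduct K1 K2).
  apply: (@cond_rel_entropy_ge0 _ _ _ _ _ PX (mkproduct K1 K2)) => _.
  exact: (probability_setT (mixture_fun PX (mkproduct K1 K2))).
have I1_ge0 : 0 <= mutual_info PX K1.
  apply: (@cond_rel_entropy_ge0 _ _ _ _ _ PX K1) => _.
  exact: (probability_setT (mixture_fun PX K1)).
apply: adde_ge0; [apply: adde_ge0; [apply: adde_ge0|]|] => //;
  apply: mule_ge0; rewrite ?lee_fin//; apply: integral_ge0 => x _;
  apply: integral_ge0 => y _; rewrite ?lee_fin//.
by apply: integral_ge0 => z _; rewrite lee_fin.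
Qed.

Lemma cvge_squeeze_harmonic (R : realType) (u : nat -> \bar R) (r c : R) :
  (forall k, r%:E <= u k <= (r + k.+1%:R^-1 * c)%:E) ->
  u @ \oo --> r%:E.
Proof.
move=> ru.
have uE k : u k = (fine (u k))%:E.
  rewrite fineK// fin_real//; have /andP[ruk uk] := ru k.
  by rewrite (lt_le_trans _ ruk) ?ltNyr//= (le_lt_trans uk) ?ltry.
apply: cvg_EFin; first by apply: nearW => k; rewrite uE.
apply: (@squeeze_cvgr _ _ _ _ (cst r) (fun k => r + harmonic k * c)%R).
- by apply: nearW => k /=; have := ru k; rewrite uE !lee_fin.
- exact: cvg_cst.
- rewrite -[X in _ --> X]addr0 -[X in _ --> (_ + X)%R](mul0r c).
  apply: cvgD; first exact: cvg_cst.
  by apply: cvgMl; exact: cvg_harmonic.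
Qed.

Theorem theorem7
  (dX dY1 dY2 : measure_display) (X : measurableType dX)
  (Y1 : measurableType dY1) (Y2 : measurableType dY2) (R : realType)
  (PX : probability X R) (dist1 : X -> Y1 -> R) (dist2 : X -> Y2 -> R)
  (hd1m : measurable_fun [set: X * Y1] (fun p => dist1 p.1 p.2))
  (hd2m : measurable_fun [set: X * Y2] (fun p => dist2 p.1 p.2))
  (hd1 : forall x y1, (0 <= dist1 x y1)%R)
  (hd2 : forall x y2, (0 <= dist2 x y2)%R)
  (nu1 lam1 lam2 : R) (hnu1 : (0 < nu1)%R) (hlam1 : (0 < lam1)%R)
  (hlam2 : (0 < lam2)%R)
  (* an optimal pair of kernels attaining F(nu1, lam1, lam2) *)
  (K1s : R.-pker X ~> Y1) (K2s : R.-pker (X * Y1) ~> Y2)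
  (hopt : srL PX dist1 dist2 nu1 lam1 lam2 K1s K2s
          = srF PX dist1 dist2 nu1 lam1 lam2)
  (* conditional law of Y2* given Y1* (P_{Y1*} = mixture PX K1s) *)
  (P21s : R.-pker Y1 ~> Y2)
  (hP21s : is_cond_law PX K1s K2s (mixture PX K1s) P21s)
  (* the iteration: P1 k = P^k_{Y1}, P21 k = P^k_{Y2|Y1},
     Q1 k = P^k_{Y1|X}, Q2 k = P^k_{Y2|XY1} (k >= 1) *)
  (P1 : nat -> probability Y1 R) (P21 : nat -> R.-pker Y1 ~> Y2)
  (Q1 : nat -> R.-pker X ~> Y1) (Q2 : nat -> R.-pker (X * Y1) ~> Y2)
  (hinit1 : rel_entropy (mixture PX K1s) (P1 0%N) < +oo)
  (hinit2 : cond_rel_entropy P21s (P21 0%N) (mixture PX K1s) < +oo)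
  (hQ1 : forall k x A, measurable A ->
     Q1 k.+1 x A =
     \int[P1 k]_(y1 in A)
       ((beta2 dist2 lam2 (P21 k) x y1 `^ (1 + nu1)^-1 *
         expR (- (lam1 / (1 + nu1) * dist1 x y1))) /
        beta1 dist1 dist2 nu1 lam1 lam2 (P1 k) (P21 k) x)%R%:E)
  (hQ2 : forall k x y1 B, measurable B ->
     Q2 k.+1 (x, y1) B =
     \int[P21 k y1]_(y2 in B)
       (expR (- (lam2 * dist2 x y2)) / beta2 dist2 lam2 (P21 k) x y1)%R%:E)
  (hP1 : forall k A, measurable A -> P1 k.+1 A = mixture PX (Q1 k.+1) A)
  (hP21 : forall k, is_cond_law PX (Q1 k.+1) (Q2 k.+1) (P1 k.+1) (P21 k.+1)) :
  let Fk := fun k : nat =>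
    (1 + nu1)%:E * \int[PX]_x
      (ln (beta1 dist1 dist2 nu1 lam1 lam2 (P1 k.-1) (P21 k.-1) x)^-1)%:E in
  let Fopt := srF PX dist1 dist2 nu1 lam1 lam2 in
  [/\ (forall k, (1 <= k)%N -> Fk k.+1 <= Fk k),
      Fk @ \oo --> Fopt &
      forall k, (1 <= k)%N ->
        Fk k - Fopt <=
        (k%:R^-1)%:E * ((1 + nu1)%:E * rel_entropy (mixture PX K1s) (P1 0%N)
                        + cond_rel_entropy P21s (P21 0%N) (mixture PX K1s))].
Proof.
move=> Fk Fopt.
(* The value with index [k+1] is computed from the laws with index [k]. *)
have FkE k : Fk k.+1 = \int[PX]_x
    (neglog_beta dist1 dist2 nu1 lam1 lam2 (P1 k) (P21 k) x)%:E.
  have l0 x : 0 <= (ln (beta1 dist1 dist2 nu1 lam1 lam2 (P1 k) (P21 k) x)^-1)%:E.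
    have := neglog_beta_ge0 hd1m hd2m hd1 hd2 hnu1 hlam1 hlam2 (P1 k) (P21 k) x.
    by rewrite lee_fin /neglog_beta pmulr_rge0// addr_gt0.
  rewrite /Fk /= -ge0_integralZl//.
    apply/measurable_EFinP; apply: (measurableT_comp (@measurable_ln R)).
    by apply: measurable_funV_gt0 => [|x]; [exact: measurable_beta1
      |exact: beta1_gt0].
  by rewrite lee_fin addr_ge0// ltW.
have dec k : Fk k.+2 <= Fk k.+1.
  rewrite !FkE; exact: (iterate_nonincreasing hd1m hd2m hd1 hd2 hnu1 hlam1
    hlam2 hQ1 hQ2 hP1 hP21).
have lb k : Fopt <= Fk k.+1.
  rewrite FkE; apply: (le_trans _ (srL_iterate_le hd1m hd2m hd1 hd2 hnu1 hlam1
    hlam2 hQ1 hQ2 hP1 hP21 k)).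
  by apply: ereal_inf_lbound; exists (Q1 k.+1), (Q2 k.+1).
have Fopt_ge0 : 0 <= Fopt by rewrite /Fopt -hopt srL_ge0// ltW.
set D1 := rel_entropy (mixture PX K1s) (P1 0%N).
set D2 := cond_rel_entropy P21s (P21 0%N) (mixture PX K1s).
have D1_ge0 : 0 <= D1.
  by apply: rel_entropy_ge0; [exact: (probability_setT (mixture_fun PX K1s))
    |exact: probability_setT].
have D2_ge0 : 0 <= D2.
  apply: (@cond_rel_entropy_ge0 _ _ _ _ _ (mixture_fun PX K1s)) => y.
  exact: prob_kernel.
have [c Cc] : exists c : R, (1 + nu1)%:E * D1 + D2 = c%:E.
  move: D1_ge0 D2_ge0 hinit1 hinit2; rewrite -/D1 -/D2.
  case: D1 => [a| |]//; case: D2 => [b| |]// _ _ _ _.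
  by exists ((1 + nu1) * a + b)%R.
have bound k : Fopt < +oo ->
    k.+1%:R%:E * Fk k.+1 <= k.+1%:R%:E * Fopt + c%:E.
  move=> Foo; rewrite -Cc.
  have := sum_iterates_le hd1m hd2m hd1 hd2 hnu1 hlam1 hlam2 hQ1 hQ2 hP1 hP21
    hP21s hinit1 hinit2 k.
  rewrite hopt => /(_ Foo); apply: le_trans.
  (* The last of [k+1] nonincreasing values is at most each of them, so [k+1] copies of it are at
     most their sum. *)
  have -> : k.+1%:R%:E = \sum_(j < k.+1) 1%:E :> \bar R.
    by rewrite sumEFin sumr_const card_ord.
  rewrite ge0_sume_distrl//; apply: lee_sum => j _; rewrite mul1e -FkE.
  have /nonincreasing_seqP := dec : forall k, (Fk k.+2 <= Fk k.+1)%O.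
  by apply; rewrite -ltnS.
have {}bound k : Fopt < +oo -> Fk k.+1 - Fopt <= (k.+1%:R^-1 * c)%:E.
  have := bound k; have := lb k; have := Fopt_ge0.
  case: (Fopt) => [r| |]// _ + + Foo.
  case: (Fk k.+1) => [s| |]//; last first.
    by move=> _ /(_ Foo); rewrite gt0_muley ?lte_fin ?ltr0n.
  move=> _ /(_ Foo); rewrite -!EFinM -EFinD -EFinB !lee_fin => h.
  rewrite -(ler_pM2l (_ : 0 < k.+1%:R)%R) ?ltr0n// mulrA mulfV ?mul1r.
    by rewrite mulrBr lerBlDl.
  by rewrite pnatr_eq0.
split.
- by case=> // k _; exact: dec.
(* Index 0 lies outside the iteration: through [k.-1], [Fk 0] merely repeats the normalizer used in
   [Fk 1]. *)
- rewrite -cvg_shiftS /=.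
  have [Foo|] := ltP Fopt +oo; last first.
    rewrite leye_eq => /eqP Foo.
    (* If the infimum is [+oo], the lower bound [lb] forces every term to be [+oo]. *)
    rewrite (_ : (fun k => _) = cst +oo).
      by rewrite Foo; exact: cvg_cst.
    by apply/funext => k /=; apply/eqP; rewrite -leye_eq -Foo.
  have [r rE] : exists r : R, Fopt = r%:E.
    by move: Fopt_ge0 Foo; case: (Fopt) => [r| |]//; exists r.
  rewrite rE; apply: (@cvge_squeeze_harmonic _ _ _ c) => k.
  by have := bound k Foo; rewrite rE leeBlDr// -EFinD addrC -rE lb.
- case=> // k _; rewrite Cc.
  have [Foo|] := ltP Fopt +oo; first by rewrite -EFinM; exact: bound.
  (* For an infinite infimum the difference is [-oo] by convention, even when [Fk] is [+oo]. *)
  by rewrite leye_eq => /eqP ->; rewrite addeNy leNye.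
Qed.
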